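(* Let $K$ be a field of characteristic zero, $R=K[x,y,z]$, $s\ge 3$, and let $I=(L_1^{a_1},\dots,L_s^{a_s})$, where $L_1,\dots,L_s$ are general linear forms and $a_1,\dots,a_s$ are positive integers. Set $$p=\max\Big\{j\;\Big|\;\sum_{a_i\le j}(j+1-a_i)\le j\Big\},$$ and let $L$ be a general linear form. Then there exists an integer $j$ for which $\times L^3:[R/I]_{j-3}\to[R/I]_j$ fails to have maximal rank if and only if $$\#\{i\mid a_i\le p+1\}=p+2-\sum_{a_i\le p}(p+1-a_i)\ \ge 4,$$ this number is even, and no $a_i$ equals $p+2$. Moreover, in this case maximal rank fails in exactly one degree, namely $j=p+2$; in that degree $\dim[R/I]_{p-1}=\dim[R/I]_{p+2}$ and the cokernel of $\times L^3:[R/I]_{p-1}\to[R/I]_{p+2}$ has dimension $1$.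
   Context: A map has maximal rank if it is injective or surjective. A sum over an empty index set is zero. ''General'' means in a suitable nonempty Zariski open set. *)

(* Defs.v *)
From HB Require Import structures.
From mathcomp Require Import all_boot all_order all_algebra.
From mathcomp Require Export mpoly.
Set Implicit Arguments. Unset Strict Implicit. Unset Printing Implicit Defensive.
Import GRing.Theory.
Local Open Scope ring_scope.

(* f lies in R_d, the degree-d homogeneous part of K[x,y,z] (d : int; for
   d < 0 this forces f = 0). *)
Definition homog_of (K : fieldType) (d : int) (f : {mpoly K[3]}) : Prop :=
  forall m, m \in msupp f -> (mdeg m)%:Z = d.

Definition linform (K : fieldType) (c : 'I_3 -> K) : {mpoly K[3]} :=
  \sum_(k < 3) c k *: 'X_k.

Definition ideal_part (K : fieldType) (s : nat) (G : 'I_s -> {mpoly K[3]})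
  (e : 'I_s -> nat) (d : int) (f : {mpoly K[3]}) : Prop :=
  exists g : 'I_s -> {mpoly K[3]},
    (forall i, homog_of (d - (e i)%:Z) (g i)) /\ f = \sum_(i < s) g i * G i.

Definition quot_dim (K : fieldType) (V W : {mpoly K[3]} -> Prop) (n : nat) : Prop :=
  exists b : 'I_n -> {mpoly K[3]},
    (forall k, V (b k)) /\
    (forall f, V f -> exists c : 'I_n -> K, W (f - \sum_(k < n) c k *: b k)) /\
    (forall c : 'I_n -> K, W (\sum_(k < n) c k *: b k) -> forall k, c k = 0).

Definition mult_injective (K : fieldType) (s : nat) (G : 'I_s -> {mpoly K[3]})
  (e : 'I_s -> nat) (M : {mpoly K[3]}) (d : int) : Prop :=
  forall f, homog_of (d - 3) f -> ideal_part G e d (M * f) -> ideal_part G e (d - 3) f.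

Definition mult_image_plus_ideal (K : fieldType) (s : nat) (G : 'I_s -> {mpoly K[3]})
  (e : 'I_s -> nat) (M : {mpoly K[3]}) (d : int) (h : {mpoly K[3]}) : Prop :=
  exists f, homog_of (d - 3) f /\ ideal_part G e d (h - M * f).

Definition mult_surjective (K : fieldType) (s : nat) (G : 'I_s -> {mpoly K[3]})
  (e : 'I_s -> nat) (M : {mpoly K[3]}) (d : int) : Prop :=
  forall h, homog_of d h -> mult_image_plus_ideal G e M d h.

Definition mult_max_rank (K : fieldType) (s : nat) (G : 'I_s -> {mpoly K[3]})
  (e : 'I_s -> nat) (M : {mpoly K[3]}) (d : int) : Prop :=
  mult_injective G e M d \/ mult_surjective G e M d.

(* Coordinates of the s+1 linear forms L_1..L_s, L in K^(3(s+1)):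
   form t (t < s for L_(t+1), t = s for L), coefficient k. *)
Definition coef_index (s : nat) (t : 'I_s.+1) (k : 'I_3) : 'I_(s.+1 * 3) :=
  mxvec_index t k.

(* Main.v *)
(* A linear functional w on R_j killing (L^3)_j is, in coordinates with L = z, a
   polynomial A(t) + B(t) z + C(t) z^2 with deg A <= j, deg B < j, deg C < j - 1,
   and w kills (L_i^(a_i))_j exactly when this polynomial vanishes to order
   j + 1 - a_i at the point of L_i.  Putting the points on the two lines z = 0
   and z = 1 and counting zeros shows first A = 0, then B = 0, then C = 0; this
   bounds the cokernel of L^3 for one choice of the forms, hence for general
   ones by semicontinuity of rank.  These bounds give injectivity in degrees
   j <= p + 1 unless the map is surjective, and surjectivity in degrees
   j >= p + 3.  In degree p + 2 the bound is 0, except when p + 2 - sum_(a_i <= p)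
   (p + 1 - a_i) = #{i | a_i <= p + 1} is an even number 2k and no a_i is p + 2,
   where it is 1.  If k = 1, only two powers are involved and their Koszul
   syzygy makes L^3 injective.  If k >= 2, the cokernel is nonzero because of
   the curve of degree p + 2 made of lines through the point of L and of twice
   a curve of degree k with a point of multiplicity k - 1 there, while the
   L_i^(a_i) have no syzygy of degree p + 2, so that both spaces have the same
   dimension. *)
From HB Require Import structures.
Require Import Defs.
From mathcomp Require Import all_boot all_order all_algebra.
From mathcomp Require Import mpoly zify ring.
Set Implicit Arguments. Unset Strict Implicit. Unset Printing Implicit Defensive.
Import GRing.Theory.
Local Open Scope ring_scope.

(** * Generic properties and families depending polynomially on parameters *)

Section Genericity.
Variables (K : fieldType) (N : nat).
Implicit Types (v : 'I_N -> K).

(** The parity condition is an obstruction in the zero count. A point of multiplicity [m] on the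
    line z = 0 gives [m], [m - 1], [m - 2] zeros to A, B, C, and on z = 1 the reverse, while A, B, C
    need [j + 1], [j], [j - 1]. If [n] points give B exactly [j] zeros, then A and C together
    receive exactly the [2 j] they need, so neither may have one too many. Moving a point between
    the lines transfers two zeros, and the balance puts [(n + 1) / 2] points on z = 0: possible only
    for odd [n]. For even [n] one extra condition has to be bought, which is the cokernel of
    dimension 1. Each degree uses its own special position, and one open set must serve all degrees.
    This works because only the degrees up to [p + 3] impose conditions. Failure of surjectivity
    holds for every choice of forms. Up to degree [p] the bound on the cokernel also forces the
    powers to be independent. In degree [p + 2] it does not, so a second special position is used
    there: the [2 k] points are split evenly between two lines, and a syzygy is differentiated along
    directions dual to lines until nothing is left. *)

Definition generic (Q : ('I_N -> K) -> Prop) :=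
  exists2 P : {mpoly K[N]}, P != 0 & forall v, P.@[v] != 0 -> Q v.

Lemma genericT (Q : ('I_N -> K) -> Prop) : (forall v, Q v) -> generic Q.
Proof. by move=> Qv; exists 1; rewrite ?oner_neq0. Qed.

Lemma generic_imp (Q Q' : ('I_N -> K) -> Prop) :
  (forall v, Q v -> Q' v) -> generic Q -> generic Q'.
Proof. by move=> QQ' [P P0 PQ]; exists P => // v /PQ /QQ'. Qed.

Lemma generic_and (Q Q' : ('I_N -> K) -> Prop) :
  generic Q -> generic Q' -> generic (fun v => Q v /\ Q' v).
Proof.
move=> [P P0 PQ] [P' P0' PQ']; exists (P * P'); first by rewrite mulf_neq0.
by move=> v; rewrite mevalM mulf_eq0 => /norP[/PQ ? /PQ' ?].
Qed.

Lemma generic_forall_lt (m : nat) (Q : nat -> ('I_N -> K) -> Prop) :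
  (forall j, (j < m)%N -> generic (Q j)) ->
  generic (fun v => forall j, (j < m)%N -> Q j v).
Proof.
elim: m => [|m IH] gQ; first exact: genericT.
have gm := gQ m (ltnSn m).
apply: generic_imp (generic_and (IH (fun j lt_jm => gQ j (ltnW lt_jm))) gm).
by move=> v [Qlt Qm] j; rewrite ltnS leq_eqVlt => /predU1P[-> | /Qlt].
Qed.

Lemma generic_forall_ord (m : nat) (Q : 'I_m -> ('I_N -> K) -> Prop) :
  (forall j, generic (Q j)) -> generic (fun v => forall j, Q j v).
Proof.
move=> gQ.
have H j : (j < m)%N -> generic (fun v => forall i : 'I_m, i = j :> nat -> Q i v).
  move=> lt_jm; apply: generic_imp (gQ (Ordinal lt_jm)) => v Qv i eq_ij.
  by rewrite (_ : i = Ordinal lt_jm) //; apply: val_inj.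
by apply: generic_imp (generic_forall_lt H) => v Qv j; apply: (Qv j).
Qed.

(** A finite list of pairs avoids choosing a basis of [V], which may be the infinite-dimensional
    ring of polynomials in three variables. *)
Definition polymap (V : lmodType K) (Y : ('I_N -> K) -> V) :=
  exists s : seq ({mpoly K[N]} * V), forall v, Y v = \sum_(x <- s) x.1.@[v] *: x.2.

Lemma polymapC (V : lmodType K) (y : V) : polymap (fun=> y).
Proof.
by exists [:: (1, y)] => v; rewrite big_seq1 /= meval1 scale1r.
Qed.

Lemma polymapD (V : lmodType K) (Y Y' : ('I_N -> K) -> V) :
  polymap Y -> polymap Y' -> polymap (fun v => Y v + Y' v).
Proof. by move=> [s Ys] [s' Ys']; exists (s ++ s') => v; rewrite big_cat Ys Ys'. Qed.

Lemma polymap_sum (V : lmodType K) (I : Type) (r : seq I) (P : pred I)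
    (Y : I -> ('I_N -> K) -> V) :
  (forall i, polymap (Y i)) -> polymap (fun v => \sum_(i <- r | P i) Y i v).
Proof.
move=> pY; elim: r => [|i r IH].
  by exists [::] => v; rewrite !big_nil.
have [s Es] : polymap (fun v => (if P i then Y i v else 0) + \sum_(j <- r | P j) Y j v).
  by apply: polymapD IH; case: (P i) => //; apply: polymapC.
by exists s => v; rewrite -Es big_cons; case: (P i); rewrite ?add0r.
Qed.

Lemma polymap_linear (V W : lmodType K) (f : {linear V -> W}) Y :
  polymap Y -> polymap (fun v => f (Y v)).
Proof.
move=> [s Ys]; exists [seq (x.1, f x.2) | x <- s] => v.
by rewrite Ys linear_sum big_map; apply: eq_bigr => x _; rewrite linearZ.
Qed.

Lemma polymapM (A : algType K) (Y Y' : ('I_N -> K) -> A) :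
  polymap Y -> polymap Y' -> polymap (fun v => Y v * Y' v).
Proof.
move=> [s Ys] [s' Ys'].
exists [seq (x.1 * y.1, x.2 * y.2) | x <- s, y <- s'] => v.
rewrite big_allpairs_dep Ys Ys' mulr_suml; apply: eq_bigr => x _.
rewrite mulr_sumr; apply: eq_bigr => y _ /=.
by rewrite mevalM -scalerAl -scalerAr scalerA.
Qed.

Lemma polymapX (A : algType K) (Y : ('I_N -> K) -> A) k :
  polymap Y -> polymap (fun v => Y v ^+ k).
Proof.
move=> pY; elim: k => [|k [s Es]]; first exact: polymapC.
have [s' Es'] : polymap (fun v => Y v * Y v ^+ k).
  by apply: polymapM => //; exists s.
by exists s' => v; rewrite exprS.
Qed.

Lemma polymap_scalar (Y : ('I_N -> K) -> K^o) :
  polymap Y -> exists P : {mpoly K[N]}, forall v, Y v = P.@[v].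
Proof.
move=> [s Ys]; exists (\sum_(x <- s) x.2 *: x.1) => v.
rewrite Ys raddf_sum; apply: eq_bigr => x _ /=.
by rewrite mevalZ mulrC.
Qed.

Lemma polymap_coord i : polymap (fun v => v i : K^o).
Proof. by exists [:: ('X_i, 1)] => v; rewrite big_seq1 /= mevalXU -[RHS]/(_ * _) mulr1. Qed.

(* The coordinate functions of [Y v0] extend to the whole space and their
   values on [Y v] form a matrix that is the identity at [v0]. *)
Lemma generic_free (V : vectType K) r (Y : 'I_r -> ('I_N -> K) -> V) v0 :
  (forall k, polymap (Y k)) -> free [tuple Y k v0 | k < r] ->
  generic (fun v => free [tuple Y k v | k < r]).
Proof.
move=> pY fr0; set X0 := [tuple Y k v0 | k < r].
have cE k l : exists P : {mpoly K[N]}, forall v, coord X0 l (Y k v) = P.@[v].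
  apply: polymap_scalar.
  exact: (polymap_linear (coord X0 l : {linear V -> K^o}) (pY k)).
have [Q QE] : exists Q : 'I_r -> 'I_r -> {mpoly K[N]},
    forall k l v, coord X0 l (Y k v) = (Q k l).@[v].
  have /fin_all_exists[q qE] : forall kl : 'I_r * 'I_r, exists P : {mpoly K[N]},
      forall v, coord X0 kl.2 (Y kl.1 v) = P.@[v] by move=> kl; apply: cE.
  by exists (fun k l => q (k, l)) => k l v; rewrite (qE (k, l)).
pose QM := \matrix_(k < r, l < r) Q k l.
have detE v : (\det QM).@[v] = \det (\matrix_(k < r, l < r) coord X0 l (Y k v)).
  rewrite -det_map_mx; congr (\det _); apply/matrixP => k l.
  by rewrite !mxE QE.
have YE v (k : 'I_r) : [tuple Y l v | l < r]`_k = Y k v.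
  by rewrite -tnth_nth tnth_mktuple.
exists (\det QM) => [|v].
  apply: contraTneq isT => D0; have := detE v0; rewrite D0 meval0.
  rewrite (_ : (\matrix_(k, l) _) = 1%:M) ?det1 => [/eqP|].
    by rewrite eq_sym oner_eq0.
  apply/matrixP => k l; rewrite !mxE -(YE v0) coord_free //.
rewrite detE => D0; apply/freeP => c c0 k.
set M := \matrix_(k, l) _ in D0.
have /eqP : \row_l c l *m M == 0.
  apply/eqP/rowP => l; rewrite !mxE.
  transitivity (coord X0 l (\sum_(i < r) c i *: [tuple Y l v | l < r]`_i)).
    rewrite linear_sum; apply: eq_bigr => i _.
    by rewrite !mxE linearZ YE.
  by rewrite c0 linear0.
have uM : M \in unitmx by rewrite unitmxE unitfE.
move/(congr1 (mulmx^~ (invmx M))); rewrite mulmxK // mul0mx => /rowP/(_ k).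
by rewrite !mxE.
Qed.

End Genericity.

(** * Homogeneous parts of the ideal as finite-dimensional spaces *)

Section Homogeneous.
Variable K : fieldType.
Local Notation P3 := {mpoly K[3]}.
Local Notation U := (dhomog 3 K).

Lemma homog_ofP (j : nat) (f : P3) : homog_of j%:Z f <-> f \is j.-homog.
Proof.
split=> [h | /dhomogP h m mf]; last by rewrite h.
by apply/dhomogP => m mf; have [] := h m mf.
Qed.

Lemma homog_of_neg (d : int) (f : P3) : d < 0 -> homog_of d f -> f = 0.
Proof.
move=> d0 h; apply/mpolyP => m; rewrite mcoeff0; apply/memN_msupp_eq0/negP => mf.
by have := h m mf; lia.
Qed.

Lemma homog_of0 (d : int) : homog_of d (0 : P3).
Proof. by move=> m; rewrite msupp0. Qed.

Lemma linform_homog (c : 'I_3 -> K) : linform c \is 1.-homog.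
Proof.
by apply: rpred_sum => k _; apply: rpredZ; rewrite dhomogX /= mdeg1.
Qed.

Lemma linform_exp_homog (c : 'I_3 -> K) e : linform c ^+ e \is e.-homog.
Proof. by have := dhomogMn e (linform_homog c); rewrite mul1n. Qed.

(** A total projection makes multiplication and differentiation linear maps between the spaces
    [dhomog] without degree proofs in the terms; [hprojK] removes it when the degree is right. *)
Definition hproj j (p : P3) : U j := DHomog (pihomogP mdeg j p).

Lemma hproj_is_linear j : linear (hproj j).
Proof. by move=> a p q; apply: val_inj; rewrite /= linearP. Qed.

HB.instance Definition _ j :=
  GRing.isLinear.Build K P3 (U j) _ (hproj j) (@hproj_is_linear j).

Lemma hprojK j (p : P3) : p \is j.-homog -> val (hproj j p) = p.
Proof. by move=> hp; rewrite /= pihomog_dE. Qed.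

Lemma hproj_val j (u : U j) : hproj j (val u) = u.
Proof. by apply: val_inj; rewrite (hprojK (dhomog_is_dhomog u)). Qed.

Lemma hproj_eq0 j d (p : P3) : p \is d.-homog -> d != j -> hproj j p = 0.
Proof. by move=> hp dj; apply: val_inj; rewrite /= (pihomog_ne0 dj). Qed.

Definition mulh d j (G : P3) (f : U d) : U j := hproj j (val f * G).

Lemma mulh_is_linear d j G : linear (@mulh d j G).
Proof. by move=> a p q; rewrite /mulh linearP /= mulrDl -scalerAl linearP. Qed.

HB.instance Definition _ d j G :=
  GRing.isLinear.Build K (U d) (U j) _ (@mulh d j G) (@mulh_is_linear d j G).

Definition mulV d j (G : P3) : {vspace U j} := limg (linfun (@mulh d j G)).

Lemma mulVP d j G (x : U j) :
  reflect (exists f : U d, x = hproj j (val f * G)) (x \in mulV d j G).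
Proof.
apply: (iffP idP) => [/memv_imgP[f _ ->]|[f ->]]; first by exists f; rewrite lfunE.
by rewrite -[hproj j _]/(mulh j G f) -lfunE memv_img ?memvf.
Qed.

Lemma mem_mulV d j G (f : U d) : hproj j (val f * G) \in mulV d j G.
Proof. by apply/mulVP; exists f. Qed.

Lemma dim_U j : \dim {:U j} = 'C(j + 2, j).
Proof. by rewrite dimvf. Qed.

Lemma dim_mulV_le d j G : (\dim (mulV d j G) <= 'C(d + 2, d))%N.
Proof.
rewrite -dim_U -(limg_ker_dim (linfun (@mulh d j G)) fullv); exact: leq_addl.
Qed.

Lemma mulh_inj d j e G (f : U d) : G != 0 -> G \is e.-homog -> (d + e)%N = j ->
  hproj j (val f * G) = 0 -> f = 0.
Proof.
move=> G0 hG dej /(congr1 val); rewrite hprojK => [/eqP|]; last first.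
  by rewrite -dej (dhomogM (dhomog_is_dhomog f) hG).
by rewrite mulf_eq0 (negPf G0) orbF => /eqP f0; apply: val_inj.
Qed.

Lemma dim_mulV d j e G : G != 0 -> G \is e.-homog -> (d + e)%N = j ->
  \dim (mulV d j G) = 'C(d + 2, d).
Proof.
move=> G0 hG dej; rewrite limg_dim_eq ?dim_U //; apply/eqP.
rewrite -subv0; apply/subvP => f; rewrite memv_cap memv_ker lfunE => /andP[_ /eqP f0].
by rewrite memv0 (mulh_inj G0 hG dej f0).
Qed.

Section Family.
Variable T : finType.
Implicit Types (c : T -> 'I_3 -> K) (e : T -> nat).

(** The index type is left free so that ['I_s] yields the ideal of the powers and [option 'I_s],
    with [None] for the form [L] and exponent 3, yields that ideal plus [L^3]. *)
Definition Ispace c e j : {vspace U j} :=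
  (\sum_(t | (e t <= j)%N) mulV (j - e t) j (linform (c t) ^+ e t))%VS.

Lemma mem_Ispace c e j t (f : P3) : f \is (j - e t).-homog -> (e t <= j)%N ->
  hproj j (f * linform (c t) ^+ e t) \in Ispace c e j.
Proof.
move=> hf le_ej; apply: (subvP (sumv_sup t le_ej (subvv _))).
by rewrite -(hprojK hf) mem_mulV.
Qed.

Lemma IspaceP c e j (x : U j) : x \in Ispace c e j <->
  exists g : T -> P3, (forall t, homog_of (j%:Z - (e t)%:Z) (g t)) /\
     val x = \sum_t g t * linform (c t) ^+ e t.
Proof.
split=> [/memv_sumP[us us_in ->]|[g [hg xE]]].
  have /fin_all_exists[g gE] : forall t, exists g : P3,
      homog_of (j%:Z - (e t)%:Z) g /\
      ((e t <= j)%N -> val (us t) = g * linform (c t) ^+ e t).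
    move=> t; case: (leqP (e t) j) => [le_ej|lt_je]; last first.
      by exists 0; split=> [|]; [apply: homog_of0 | lia].
    have /mulVP[f fE] := us_in t le_ej.
    exists (val f); split=> [|_]; first by rewrite subzn //; apply/homog_ofP; exact: dhomog_is_dhomog.
    rewrite fE hprojK //; have := dhomogM (dhomog_is_dhomog f) (linform_exp_homog (c t) (e t)).
    by rewrite subnK.
  exists g; split=> [t|]; first by case: (gE t).
  rewrite raddf_sum big_mkcond; apply: eq_bigr => t _; have [hg gt] := gE t.
  case: leqP => [/gt //|lt_je].
  by rewrite (homog_of_neg _ hg) ?mul0r //; lia.
rewrite -(hproj_val x) xE linear_sum; apply: memv_suml => t _.
case: (leqP (e t) j) => [le_ej|lt_je].
  by apply: mem_Ispace => //; apply/homog_ofP; rewrite -subzn.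
by rewrite (homog_of_neg _ (hg t)) ?mul0r ?linear0 ?mem0v //; lia.
Qed.

Lemma dim_Ispace_le c e j :
  (\dim (Ispace c e j) <= \sum_(t | (e t <= j)%N) 'C(j - e t + 2, j - e t))%N.
Proof.
apply: leq_trans (dimv_leq_sum _ _ _) _.
by apply: leq_sum => t _; apply: dim_mulV_le.
Qed.

Lemma Ispace_eq c c' e j : (forall t, (e t <= j)%N -> c t =1 c' t) ->
  Ispace c e j = Ispace c' e j.
Proof.
move=> cc'.
have cE t : (e t <= j)%N -> linform (c t) = linform (c' t).
  by move=> le_ej; apply: eq_bigr => k _; rewrite cc'.
by rewrite /Ispace; apply: eq_bigr => t /cE ->.
Qed.

(** Semicontinuity of rank: a basis at [v0] is a combination of the powers with coefficients [g].
    Keeping [g] and moving the forms gives elements of the space at [v] that depend polynomially on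
    [v] and are independent at [v0], hence generically. *)
Lemma generic_dim_Ispace N (sg : T -> 'I_3 -> 'I_N) e j r v0 :
  (r <= \dim (Ispace (fun t k => v0 (sg t k)) e j))%N ->
  generic (fun v : 'I_N -> K => r <= \dim (Ispace (fun t k => v (sg t k)) e j))%N.
Proof.
pose c (v : 'I_N -> K) t k := v (sg t k); rewrite -/(c v0) => le_r.
set d := \dim _ in le_r; pose X := vbasis (Ispace (c v0) e j).
have /fin_all_exists[g gP] : forall k : 'I_d, exists g : T -> P3,
    (forall t, homog_of (j%:Z - (e t)%:Z) (g t)) /\
     val X`_k = \sum_t g t * linform (c v0 t) ^+ e t.
  by move=> k; apply/IspaceP; apply: vbasis_mem; apply: mem_nth; rewrite size_tuple.
pose Y (k : 'I_d) v := hproj j (\sum_t g k t * linform (c v t) ^+ e t).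
have YI k v : Y k v \in Ispace (c v) e j.
  apply/IspaceP; exists (g k); split; first by case: (gP k).
  rewrite hprojK //; apply: rpred_sum => t _; have [hg _] := gP k.
  case: (leqP (e t) j) => [le_ej|lt_je]; last first.
    by rewrite (homog_of_neg _ (hg t)) ?mul0r ?dhomog0 //; lia.
  have hg' : g k t \is (j - e t).-homog by apply/homog_ofP; rewrite -subzn.
  by have := dhomogM hg' (linform_exp_homog (c v t) (e t)); rewrite subnK.
have frY : free [tuple Y k v0 | k < d].
  rewrite (_ : tval _ = X) ?(basis_free (vbasisP _)) //.
  apply: (eq_from_nth (x0 := 0)); rewrite !size_tuple // => k lt_k.
  rewrite -(tnth_nth 0 _ (Ordinal lt_k)) tnth_mktuple /Y.
  by have [_ <-] := gP (Ordinal lt_k); rewrite hproj_val.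
have pY k : polymap (Y k).
  apply: (polymap_linear (hproj j)); apply: polymap_sum => t.
  apply: polymapM; [exact: polymapC | apply: polymapX; apply: polymap_sum => l].
  by exists [:: ('X_(sg t l), 'X_l)] => v; rewrite big_seq1 mevalXU.
apply: generic_imp (generic_free pY frY) => v; set X' := [tuple _ | _ < _] => frX'.
apply: leq_trans le_r _; rewrite -(size_tuple X') -(eqP frX').
apply: dimvS; apply/span_subvP => x /tnthP[k ->].
by rewrite tnth_mktuple.
Qed.

End Family.
End Homogeneous.

(** A vector outside [U + X] would be detected by a functional vanishing on that sum. In the
    applications [X] holds the extra conditions, and its dimension bounds the cokernel. *)
Lemma dim_of_killed (K : fieldType) (V : vectType K) (U X : {vspace V}) :
  (forall w : {linear V -> K^o}, (forall x, x \in U -> w x = 0) ->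
     (forall x, x \in X -> w x = 0) -> forall x, w x = 0) ->
  (\dim {:V} <= \dim U + \dim X)%N.
Proof.
move=> kill; set Y := (U + X)%VS.
suff <-: Y = fullv by apply: dimv_add_leqif.
apply/vspaceP => x; rewrite memvf; apply: contraT => xY.
pose f := (\1 - projv Y)%VF.
have fE z : f z = z - projv Y z by rewrite /f add_lfunE opp_lfunE id_lfunE.
have fY z : z \in Y -> f z = 0 by move=> zY; rewrite fE projv_id ?subrr.
have fx : f x != 0.
  by apply: contraNneq xY; rewrite fE => /eqP; rewrite subr_eq0 => /eqP->; apply: memv_proj.
pose y := f x; pose w : {linear V -> K^o} := coord [tuple y] ord0 \o f.
have /eqP : w x = 0.
  apply: kill => z zU; rewrite /= fY ?linear0 //.
    by apply: subvP zU; apply: addvSl.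
  by apply: subvP zU; apply: addvSr.
rewrite /= -[f x]/y -[y in coord _ _ y]/([tuple y]`_(@ord0 0)) coord_free ?eqxx ?oner_eq0 //.
by rewrite seq1_free.
Qed.

(** * Zeros of univariate polynomials, counted with multiplicity *)

Section UnivariateVanishing.
Variable K : fieldType.
Implicit Types (p q : {poly K}).

Lemma prod_dvdp (I : eqType) (r : seq I) (t : I -> K) (al : I -> nat) p :
  uniq r -> {in r &, injective t} ->
  (forall i, i \in r -> ('X - (t i)%:P) ^+ al i %| p) ->
  \prod_(i <- r) ('X - (t i)%:P) ^+ al i %| p.
Proof.
elim: r => [|i r IH] /=; first by rewrite big_nil dvd1p.
move=> /andP[ir ur] inj dv; rewrite big_cons Gauss_dvdp; last first.
  rewrite big_seq; elim/big_ind: _ => [|f g cf cg|k kr]; first exact: coprimep1.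
    by rewrite coprimepMr cf cg.
  apply: coprimep_expl; apply: coprimep_expr.
  rewrite coprimep_XsubC root_XsubC.
  by apply: contraNneq ir => /inj <- //; rewrite inE ?eqxx ?kr ?orbT.
rewrite dv ?inE ?eqxx //=; apply: IH => // [k l kr lr|k kr].
  by apply: inj; rewrite inE ?kr ?lr orbT.
by apply: dv; rewrite inE kr orbT.
Qed.

Lemma poly_eq0_of_dvdp (I : finType) (t : I -> K) (al : I -> nat) p :
  injective t -> (forall i, ('X - (t i)%:P) ^+ al i %| p) ->
  (size p <= \sum_i al i)%N -> p = 0.
Proof.
move=> inj dv szp; apply/eqP; apply: contraT => p0.
have := @prod_dvdp I (index_enum I) t al p (index_enum_uniq I) (in2W inj) (fun i _ => dv i).
move=> /(dvdp_leq p0); rewrite size_prod_seq; last first.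
  by move=> i _; rewrite expf_neq0 // polyXsubC_eq0.
rewrite (eq_bigr (fun i => (al i + 1)%N)); last first.
  by move=> i _; rewrite size_exp_XsubC addn1.
rewrite big_split /= sum1_size -addSn addnK => h.
by have := leq_trans h szp; rewrite ltnn.
Qed.

Lemma mulrn_dvdp (d p : {poly K}) n : n%:R != 0 :> K -> (d %| p *+ n) = (d %| p).
Proof. by move=> n0; rewrite -mulr_natl -polyC_natr mul_polyC dvdpZr. Qed.

(** Compares the values at z = 2 and z = 1 of a quadratic in z without constant term, so that only
    the coefficient of z^2 survives. *)
Lemma lincomb_C (B C : {poly K}) j c :
  2%:R *: B *+ j + 2%:R ^+ 2 *: C *+ c - (B *+ j + C *+ c) *+ 2 = C *+ c *+ 2.
Proof.
rewrite !scalerMnr; move: (B *+ j) (C *+ c) => x y.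
rewrite -!scaler_nat scalerDr opprD addrACA subrr add0r -scalerBl.
by rewrite expr2 mulr_natr mulr2n addrK.
Qed.

(** Since [j (j - 1) = 2 'C(j, 2)], the terms in [C] cancel between a value at z = 1 and a
    z-derivative there. *)
Lemma lincomb_B (B C : {poly K}) j :
  (B *+ j + C *+ 'C(j, 2)) *+ 2 - (B + C *+ (j - 1)) *+ j = B *+ j.
Proof.
have Ej : C *+ (j - 1) *+ j = C *+ 'C(j, 2) *+ 2.
  by rewrite -!mulrnA [('C(j, 2) * 2)%N]mulnC (mul_bin_left j 1) bin1.
rewrite [(B + _) *+ j]mulrnDl Ej; move: (B *+ j) (C *+ _) => x y.
by rewrite mulrnDl opprD addrACA subrr addr0 mulr2n addrK.
Qed.

End UnivariateVanishing.

(* Lower bounds for the order of vanishing at [t] of the three coefficients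
   A, B, C of A + B z + C z^2, imposed by multiplicity [m] at (t, 0)
   ([Some false]) or (t, 1) ([Some true]), or by the whole line over [t]
   ([None]); for (t, 1) the bound for B uses A = 0 and the one for C also uses
   B = 0. *)
Definition vordA (k : option bool) (m : nat) : nat :=
  match k with Some false => m | Some true => (m - 2)%N | None => 1%N end.
Definition vordB (k : option bool) (m : nat) : nat := if k then (m - 1)%N else 1%N.
Definition vordC (k : option bool) (m : nat) : nat :=
  match k with Some false => (m - 2)%N | Some true => m | None => 1%N end.

(** * Linear functionals on forms of degree [j], read as polynomials in t and z *)

Section Functional.
Variables (K : fieldType) (charK0 : [pchar K] =i pred0).
Local Notation P3 := {mpoly K[3]}.
Local Notation U := (dhomog 3 K).

Lemma natr_neq0 n : (0 < n)%N -> n%:R != 0 :> K.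
Proof. by move=> n0; rewrite ((pcharf0P K).1 charK0) -lt0n. Qed.

Lemma natr_inj : injective (fun n : nat => n%:R : K).
Proof.
move=> m n; wlog le_mn : m n / (m <= n)%N => [H e|e].
  by case: (leqP m n) => [/H ->|/ltnW/H ->].
apply/eqP; rewrite eqn_leq le_mn /= -subn_eq0.
by rewrite -((pcharf0P K).1 charK0) natrB // e subrr.
Qed.

Definition vec3 (x y z : K) (k : 'I_3) : K := [:: x; y; z]`_k.
Definition X0 : P3 := 'X_(@Ordinal 3 0 isT).
Definition X1 : P3 := 'X_(@Ordinal 3 1 isT).
Definition X2 : P3 := 'X_(@Ordinal 3 2 isT).

Lemma linform_vec3 x y z : linform (vec3 x y z) = x *: X0 + y *: X1 + z *: X2.
Proof.
rewrite /linform !big_ord_recl big_ord0 addr0 addrA /vec3 /X0 /X1 /X2 /=.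
by congr (_ *: 'X_ _ + _ *: 'X_ _ + _ *: 'X_ _); apply: val_inj.
Qed.

Lemma var_homog k : ('X_k : P3) \is 1.-homog.
Proof. by rewrite dhomogX /= mdeg1. Qed.

Lemma exp_homog (p : P3) e : p \is 1.-homog -> p ^+ e \is e.-homog.
Proof. by move=> h; have := dhomogMn e h; rewrite mul1n. Qed.

Lemma mpolyX3 (m : 'X_{1..3}) : exists a b c, 'X_[m] = X0 ^+ a * X1 ^+ b * X2 ^+ c.
Proof.
exists (m (@Ordinal 3 0 isT)), (m (@Ordinal 3 1 isT)), (m (@Ordinal 3 2 isT)).
rewrite mpolyXE_id !big_ord_recl big_ord0 mulr1 mulrA.
by congr ('X_ _ ^+ m _ * 'X_ _ ^+ m _ * 'X_ _ ^+ m _); apply: val_inj.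
Qed.

Variables (j : nat) (w : {linear U j -> K^o}).
Local Notation W p := (w (hproj j p)).

Lemma W_eq0_of_monomials : (forall a b c, (a + b + c)%N = j ->
  W (X0 ^+ a * X1 ^+ b * X2 ^+ c) = 0) -> forall x, w x = 0.
Proof.
move=> Wm x; rewrite -(hproj_val x) [val x]mpolyE !linear_sum big_seq big1 // => m mx.
rewrite !linearZ; have [a [b [c mE]]] := mpolyX3 m.
rewrite mE /= Wm ?scaler0 //.
have mj : mdeg m = j by have /dhomogP/(_ m mx) := dhomog_is_dhomog x.
have h : X0 ^+ a * X1 ^+ b * X2 ^+ c \is (a + b + c).-homog.
  by rewrite !dhomogM // exp_homog ?var_homog.
have : ('X_[m] : P3) \is (mdeg m).-homog by rewrite dhomogX.
by rewrite mE mj; apply: dhomog_uniq h; rewrite -mE -msize_poly_eq0 msizeX.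
Qed.

Lemma W_homog_neq d p : p \is d.-homog -> d != j -> W p = 0.
Proof. by move=> hp dj; rewrite (hproj_eq0 hp dj) linear0. Qed.

Definition Wp (q : {poly P3}) : {poly K} := map_poly (fun p => W p) q.

Lemma coef_Wp q k : (Wp q)`_k = W q`_k.
Proof. by rewrite coef_map_id0 // !linear0. Qed.

Lemma Wp_is_additive : additive Wp.
Proof.
by move=> p q; apply/polyP => k; rewrite coefB !coef_Wp coefB !linearB.
Qed.

HB.instance Definition _ := GRing.isAdditive.Build _ _ Wp Wp_is_additive.

Lemma WpC p : Wp p%:P = (W p)%:P.
Proof. by apply/polyP => k; rewrite coef_Wp !coefC; case: eqP => // _; rewrite !linear0. Qed.

Lemma size_Wp q : (size (Wp q) <= size q)%N.
Proof. exact: size_poly. Qed.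

Lemma Wp_scale (z : K) p q : Wp ((z *: p)%:P * q) = z *: Wp (p%:P * q).
Proof.
apply/polyP => k; rewrite coefZ [LHS]coef_Wp coef_Wp.
by rewrite [in LHS]coefCM [in RHS]coefCM -scalerAl linearZ linearZ.
Qed.

Lemma Wp_mulXsubC q (t : K) :
  Wp (q * ('X - (t%:MP)%:P)) = Wp q * ('X - t%:P).
Proof.
apply/polyP => k; rewrite coef_Wp !mulrBr !coefB !coefMX !coefMC !coef_Wp !linearB.
rewrite [_ * t%:MP]mulrC mul_mpolyC !linearZ /= [t *: _]mulrC.
by case: eqP => _; rewrite ?linear0 mulNr /= ?linear0.
Qed.

Lemma Wp_mulXsubC_exp q (t : K) k :
  Wp (q * ('X - (t%:MP)%:P) ^+ k) = Wp q * ('X - t%:P) ^+ k.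
Proof.
elim: k => [|k IH] in q *; first by rewrite !mulr1.
by rewrite !exprSr !mulrA Wp_mulXsubC IH.
Qed.

Definition Tz (z : K) : {poly P3} := (X0 + z *: X2)%:P + X1%:P * 'X.
(** The variable of [Tz z] is t, so [Psi 0 z] is the value of [w] on the [j]-th power of the form of
    (1, t, z), and [Psi l z] is its [l]-th derivative in z up to a constant. The A, B, C of the
    overview are [Psi 0 0], [j] times [Psi 1 0] and ['C(j, 2)] times [Psi 2 0]. *)
Definition Psi l z := Wp ((X2 ^+ l)%:P * Tz z ^+ (j - l)).

Lemma TzE z t : Tz z = (linform (vec3 1 t z))%:P + X1%:P * ('X - (t%:MP)%:P).
Proof.
rewrite /Tz linform_vec3 scale1r mulrBr -polyCM [X1 * _]mulrC mul_mpolyC !polyCD.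
have H (V : zmodType) (a b d x : V) : a + d + x = a + b + d + (x - b).
  by rewrite [a + b + d]addrAC -[RHS]addrA [b + _]addrC subrK.
exact: H.
Qed.

(** Expand [Tz z] around [t] by [TzE]. The term with the [k]-th power of ['X - t] contains the form
    to the power [j - l - k]; [w] kills it if this is at least [a], and otherwise
    [k >= j + 1 - a - l]. *)
Lemma dvdp_Psi l z t a :
  (forall f : P3, f \is (j - a).-homog -> (a <= j)%N ->
      W (f * linform (vec3 1 t z) ^+ a) = 0) ->
  ('X - t%:P) ^+ (j.+1 - a - l) %| Psi l z.
Proof.
set L := linform _ => killL.
rewrite /Psi (TzE z t) -/L [(_ + X1%:P * _) ^+ _]exprDn mulr_sumr raddf_sum /=.
elim/big_ind: _ => [|p q|k _]; [exact: dvdp0 | exact: dvdp_add |].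
rewrite mulrnAr raddfMn /= (_ : _ * _ = (X2 ^+ l * L ^+ (j - l - k) * X1 ^+ k)%:P
    * ('X - (t%:MP)%:P) ^+ k); last by rewrite exprMn !polyCM !polyC_exp !mulrA.
rewrite Wp_mulXsubC_exp WpC.
case: (leqP (k + l + a) j) => [le_j|lt_j]; last first.
  rewrite -mulrnAl dvdp_mull // dvdp_exp2l //; have := ltn_ord k; lia.
rewrite (_ : X2 ^+ l * _ * _ = X2 ^+ l * L ^+ (j - l - k - a) * X1 ^+ k * L ^+ a); last first.
  rewrite (_ : (j - l - k)%N = (j - l - k - a) + a)%N; last by lia.
  by rewrite exprD addnK; ring.
rewrite killL ?mul0r ?mul0rn ?dvdp0 //; last by lia.
rewrite (_ : (j - a = l + (j - l - k - a) + k)%N); last by lia.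
by rewrite !dhomogM // exp_homog ?var_homog ?linform_homog.
Qed.

Lemma Psi_big l z : (j < l)%N -> Psi l z = 0.
Proof.
move=> lt_jl; rewrite /Psi (_ : (j - l = 0)%N); last by lia.
by rewrite mulr1 WpC (W_homog_neq (exp_homog _ (var_homog _))) //; lia.
Qed.

Lemma size_Psi l : (l <= j)%N -> (size (Psi l 0) <= (j - l).+1)%N.
Proof.
move=> le_lj; apply: leq_trans (size_Wp _) _.
apply: leq_trans (size_polyMleq _ _) _.
have sT : (size (Tz 0) <= 2)%N.
  apply: leq_trans (size_polyD _ _) _; rewrite geq_max.
  rewrite (leq_trans (size_polyC_leq1 _)) //=.
  apply: leq_trans (size_polyMleq _ _) _; rewrite size_polyX.
  by rewrite addn2; apply: size_polyC_leq1.
have H (a b n : nat) : (a <= 1)%N -> (b <= n.+1)%N -> ((a + b).-1 <= n.+1)%N by lia.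
apply: H; first exact: size_polyC_leq1.
apply: leq_trans (size_poly_exp_leq _ _) _; rewrite ltnS.
rewrite -[X in (_ <= X)%N]mul1n leq_mul2r; apply/orP; right.
by case: (size (Tz 0)) sT.
Qed.

Hypothesis killZ : forall f : P3, f \is (j - 3).-homog -> (3 <= j)%N -> W (f * X2 ^+ 3) = 0.

Lemma W_mulX2_3 f : W (f * X2 ^+ 3) = 0.
Proof.
rewrite [f]mpolyE mulr_suml !linear_sum big1 // => m _.
rewrite -scalerAl !linearZ /=.
have hm : ('X_[m] : P3) \is (mdeg m).-homog by rewrite dhomogX.
have h := dhomogM hm (exp_homog 3 (var_homog (@Ordinal 3 2 isT))).
case: (altP (mdeg m + 3 =P j)%N) => [mj|mj]; last by rewrite (W_homog_neq h mj) scaler0.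
by rewrite killZ ?scaler0 //; [rewrite -mj addnK | lia].
Qed.

Lemma Psi_ge3 l z n : (3 <= l)%N -> Wp ((X2 ^+ l)%:P * Tz z ^+ n) = 0.
Proof.
move=> le3; apply/polyP => k; rewrite coef_Wp coef0 coefCM.
by rewrite -(subnK le3) exprD mulrAC W_mulX2_3.
Qed.

(** The binomial expansion in z stops at degree two because [w] kills every multiple of
    [X2 ^+ 3]. *)
Lemma Psi_shift l z :
  Psi l z = Psi l 0 + z *: Psi l.+1 0 *+ (j - l) + z ^+ 2 *: Psi l.+2 0 *+ 'C(j - l, 2).
Proof.
pose F i := z ^+ i *: Wp ((X2 ^+ (l + i))%:P * Tz 0 ^+ (j - l - i)) *+ 'C(j - l, i).
have -> : Psi l z = \sum_(i < (j - l).+1) F i.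
  rewrite /Psi (_ : Tz z = Tz 0 + (z *: X2)%:P); last first.
    by rewrite /Tz scale0r addr0 polyCD addrAC.
  rewrite exprDn mulr_sumr raddf_sum; apply: eq_bigr => i _ /=.
  rewrite mulrnAr raddfMn /F; congr (_ *+ _).
  rewrite mulrCA mulrC -polyC_exp -polyCM exprZn -scalerAr -exprD.
  exact: Wp_scale.
have F3 i : (3 <= i)%N -> F i = 0.
  by move=> le3i; rewrite /F Psi_ge3 ?scaler0 ?mul0rn //; lia.
have Fgt i : (j - l < i)%N -> F i = 0 by move=> lt_i; rewrite /F bin_small.
have -> : \sum_(i < (j - l).+1) F i = \sum_(i < 3) F i.
  rewrite (big_ord_widen (maxn (j - l).+1 3) F) ?leq_maxl //.
  rewrite [RHS](big_ord_widen (maxn (j - l).+1 3) F) ?leq_maxr //.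
  rewrite big_mkcond [RHS]big_mkcond; apply: eq_bigr => i _.
  by case: (ltnP i (j - l).+1) => h1; case: (ltnP i 3) => h2 //; rewrite ?(F3 _ h2) ?(Fgt _ h1).
rewrite !big_ord_recl big_ord0 /F /= addr0 addrA !expr0 !expr1 scale1r addn0 addn1 addn2.
by rewrite !subnS subn0 bin0 bin1 /= /Psi !subnS mulr1n.
Qed.

Lemma horner_Wp q (t : K) : (Wp q).[t] = W q.[t%:MP].
Proof.
rewrite (horner_coef_wide _ (size_Wp q)) horner_coef !linear_sum.
apply: eq_bigr => i _; rewrite coef_Wp -rmorphXn /= mulrC.
by rewrite [q`_i * _]mulrC mul_mpolyC linearZ linearZ.
Qed.

Lemma horner_Psi0 z t : (Psi 0 z).[t] = W (linform (vec3 1 t z) ^+ j).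
Proof.
rewrite /Psi expr0 mul1r subn0 horner_Wp horner_exp (TzE z t).
by rewrite hornerD hornerM !hornerC hornerXsubC subrr mulr0 addr0.
Qed.

Lemma coef_Psi0 l b : (b <= j - l)%N ->
  (Psi l 0)`_b = W (X0 ^+ (j - l - b) * X1 ^+ b * X2 ^+ l) *+ 'C(j - l, b).
Proof.
move=> le_b; rewrite coef_Wp coefCM /Tz scale0r addr0 exprDn coef_sum.
rewrite (bigD1 (inord b)) //= inordK // big1 ?addr0 => [|i ne_ib].
  rewrite coefMn exprMn -!polyC_exp mulrA -polyCM coefCM coefXn eqxx mulr1.
  by rewrite mulrnAr !raddfMn mulrC.
rewrite coefMn exprMn -!polyC_exp mulrA -polyCM coefCM coefXn.
case: eqP => [bi|_]; last by rewrite mulr0 mul0rn.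
by case/eqP: ne_ib; apply: val_inj; rewrite /= inordK.
Qed.

(** Up to binomial coefficients, which are invertible in characteristic zero, the coefficients of
    [Psi l 0] are the values of [w] on the monomials with exponent [l] in [X2]. *)
Lemma W_eq0_of_Psi : (forall l, (l < 3)%N -> Psi l 0 = 0) -> forall x, w x = 0.
Proof.
move=> P0; apply: W_eq0_of_monomials => a b c abc.
case: (leqP 3 c) => [le3|lt3]; first by rewrite -(subnK le3) exprD mulrA W_mulX2_3.
have := @coef_Psi0 c b; rewrite P0 // coef0 => /(_ _)/esym; rewrite (_ : j - c - b = a)%N; last by lia.
rewrite -mulr_natl => H; have {H} /eqP : 'C(j - c, b)%:R * W (X0 ^+ a * X1 ^+ b * X2 ^+ c) = 0.
  by apply: H; lia.
rewrite mulf_eq0 => /orP[|/eqP //]; rewrite (negPf (natr_neq0 _)) // bin_gt0; lia.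
Qed.

(** The three inequalities say that A, B, C have more zeros than their degrees [j], [j - 1], [j - 2]
    allow. At an index of kind [None] the quadratic in z over [t i] vanishes at z = 0, 1, 2, hence
    identically, which gives each coefficient one zero. *)
Lemma W_vanish (I : finType) (t : I -> K) (kd : I -> option bool) (m : I -> nat) :
  injective t -> (forall i, m i <= j.+1)%N ->
  (forall i z, kd i = Some z -> (0 < m i)%N -> forall f, f \is (m i).-1.-homog ->
     W (f * linform (vec3 1 (t i) z%:R) ^+ (j.+1 - m i)) = 0) ->
  (forall i, kd i = None -> forall z, (z < 3)%N -> W (linform (vec3 1 (t i) z%:R) ^+ j) = 0) ->
  (j < \sum_i (vordA (kd i) (m i)))%N ->
  (j <= \sum_i vordB (kd i) (m i))%N ->
  (j.-1 <= \sum_i (vordC (kd i) (m i)))%N ->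
  forall x, w x = 0.
Proof.
move=> inj_t le_m killS killN sA sB sC.
pose tau i := 'X - (t i)%:P.
have dS i z l : kd i = Some z -> tau i ^+ (m i - l) %| Psi l z%:R.
  move=> kdi; case: (posnP (m i)) => [-> | m0]; first exact: dvd1p.
  have := @dvdp_Psi l z%:R (t i) (j.+1 - m i).
  rewrite subKn //; apply => f hf _; apply: (killS i z) => //.
  by move: hf; rewrite (_ : j - _ = (m i).-1)%N //; have := le_m i; lia.
have P30 z : Psi 3 z = 0 by exact: Psi_ge3.
have E01 z : Psi 0 z = Psi 0 0 + z *: Psi 1 0 *+ j + z ^+ 2 *: Psi 2 0 *+ 'C(j, 2).
  by rewrite Psi_shift subn0.
have E11 : Psi 1 1 = Psi 1 0 + Psi 2 0 *+ (j - 1).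
  by rewrite Psi_shift P30 scaler0 mul0rn addr0 scale1r.
have E21 : Psi 2 1 = Psi 2 0.
  by rewrite Psi_shift P30 [Psi 4 0]Psi_ge3 // !scaler0 !mul0rn !addr0.
have dMn (d p : {poly K}) n : d %| p -> d %| p *+ n.
  by move=> dp; rewrite -mulr_natl dvdp_mull.
have cB (d : {poly K}) : d %| Psi 1 0 *+ j -> d %| Psi 1 0.
  case: (posnP j) => [j0|j0]; first by rewrite Psi_big ?dvdp0 ?j0.
  by rewrite mulrn_dvdp ?natr_neq0.
have cC (d : {poly K}) : d %| Psi 2 0 *+ 'C(j, 2) -> d %| Psi 2 0.
  case: (ltnP j 2) => [j2|j2]; first by rewrite Psi_big ?dvdp0.
  have c0 : 'C(j, 2)%:R != 0 :> K by apply: natr_neq0; rewrite bin_gt0.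
  by rewrite (mulrn_dvdp _ _ c0).
have two0 := natr_neq0 (isT : 0 < 2)%N.
have dN i l : kd i = None -> (l < 3)%N -> tau i %| Psi l 0.
  move=> kdi lt_l3; have v z : (z < 3)%N -> tau i %| Psi 0 z%:R.
    by move=> z3; rewrite dvdp_XsubCl rootE horner_Psi0 killN.
  have v0 := v 0 isT; have := v 1 isT; have := v 2 isT.
  rewrite !(E01 1%:R) !(E01 2%:R) -!addrA !(dvdp_addr _ v0) expr1n !scale1r => v2 v1.
  have vC : tau i %| Psi 2 0.
    apply: cC; rewrite -(mulrn_dvdp _ _ two0).
    rewrite (_ : _ *+ 2 = (2%:R *: Psi 1 0 *+ j + 2%:R ^+ 2 *: Psi 2 0 *+ 'C(j, 2))
       - (Psi 1 0 *+ j + Psi 2 0 *+ 'C(j, 2)) *+ 2).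
      exact: (dvdp_sub v2 (dMn _ _ _ v1)).
    exact/esym/lincomb_C.
  have vB : tau i %| Psi 1 0.
    by apply: cB; rewrite -(dvdp_addl _ (dMn _ _ 'C(j, 2) vC)).
  by case: l lt_l3 => [|[|[]]].
have dF i l k : kd i = Some false -> (k <= m i - l)%N -> tau i ^+ k %| Psi l 0.
  move=> kdi le_k; have := dS i false l kdi; rewrite mulr0n.
  by apply: dvdp_trans; apply: dvdp_exp2l.
have dT i l k r : kd i = Some true -> (k <= m i - l)%N -> Psi l 1 = r -> tau i ^+ k %| r.
  move=> kdi le_k <-; have := dS i true l kdi; rewrite mulr1n.
  by apply: dvdp_trans; apply: dvdp_exp2l.
have A0 : Psi 0 0 = 0.
  apply: (poly_eq0_of_dvdp (al := fun i => vordA (kd i) (m i)) inj_t); last first.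
    apply: leq_trans sA; rewrite -[X in X.+1]subn0; exact: size_Psi (leq0n j).
  move=> i; rewrite /vordA; case kdi: (kd i) => [[]|]; last by rewrite expr1; apply: dN.
    (* On z = 1 the z-derivatives of orders 2, 1, 0 vanish to order at least [m i - 2]; subtracting
       the earlier ones passes this order from C to B and then to A. *)
    have dC := dT i 2 (m i - 2)%N _ kdi (leqnn _) E21.
    have := dT i 1 (m i - 2)%N _ kdi (leq_sub2l _ (isT : 1 <= 2)%N) E11.
    rewrite (dvdp_addl _ (dMn _ _ _ dC)) => dB.
    have := dT i 0 (m i - 2)%N _ kdi (leq_sub2l _ (isT : 0 <= 2)%N) (E01 1).
    by rewrite expr1n !scale1r (dvdp_addl _ (dMn _ _ _ dC)) (dvdp_addl _ (dMn _ _ _ dB)).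
  by apply: dF kdi _; rewrite subn0.
have B0 : Psi 1 0 = 0.
  case: (posnP j) => [j0|j0]; first by rewrite Psi_big ?j0.
  apply: (poly_eq0_of_dvdp (al := fun i => vordB (kd i) (m i)) inj_t); last first.
    apply: leq_trans sB; rewrite -[X in (_ <= X)%N](prednK j0) -subn1; exact: size_Psi j0.
  move=> i; rewrite /vordB; case kdi: (kd i) => [[]|] /=; last by rewrite expr1; apply: dN.
    have d1 := dT i 1 (m i - 1)%N _ kdi (leqnn _) E11.
    have := dT i 0 (m i - 1)%N _ kdi (leq_sub2l _ (isT : 0 <= 1)%N) (E01 1).
    rewrite expr1n !scale1r A0 add0r => d0.
    apply: cB.
    rewrite (_ : _ *+ j = (Psi 1 0 *+ j + Psi 2 0 *+ 'C(j, 2)) *+ 2 - (Psi 1 0 + Psi 2 0 *+ (j - 1)) *+ j).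
      exact: (dvdp_sub (dMn _ _ _ d0) (dMn _ _ _ d1)).
    exact/esym/lincomb_B.
  exact: dF kdi _.
have C0 : Psi 2 0 = 0.
  case: (ltnP j 2) => [j2|j2]; first by rewrite Psi_big.
  apply: (poly_eq0_of_dvdp (al := fun i => vordC (kd i) (m i)) inj_t); last first.
    apply: leq_trans sC; rewrite -subn1 -(subnSK j2); exact: size_Psi j2.
  move=> i; rewrite /vordC; case kdi: (kd i) => [[]|]; last by rewrite expr1; apply: dN.
    have := dT i 0%N (m i) _ kdi; rewrite subn0 leqnn => /(_ _ isT (E01 1)).
    by rewrite expr1n !scale1r A0 B0 mul0rn !add0r => /cC.
  exact: dF kdi _.
by apply: W_eq0_of_Psi => -[|[|[|]]].
Qed.

End Functional.

(** * Special positions and the resulting bound on the cokernel *)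

Section SpecialPosition.
Variables (K : fieldType) (charK0 : [pchar K] =i pred0).
Local Notation P3 := {mpoly K[3]}.
Local Notation U := (dhomog 3 K).

Lemma exists_subset_card (T : finType) (A : {set T}) n :
  (n <= #|A|)%N -> exists2 B : {set T}, B \subset A & #|B| = n.
Proof.
elim: n => [|n IH] le_n; first by exists set0; rewrite ?sub0set ?cards0.
have [B BA cB] := IH (ltnW le_n).
have /subsetPn[x xA xB] : ~~ (A \subset B).
  by apply: contraL le_n => /subset_leq_card; rewrite cB -leqNgt.
exists (x |: B); last by rewrite cardsU1 xB cB.
by rewrite subUset sub1set xA BA.
Qed.

Definition pw j (x : 'I_3 -> K) : U j := hproj j (linform x ^+ j).

(** [n1] of the points with [a i < j] go to z = 1 and the others to z = 0. In addition there are [l]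
    triples of simple points over a common t and [ep] points of multiplicity [mu] on z = 0; the last
    summand counts the conditions they cost. Each point gives [j - 1 - a i] zeros to all three
    coefficients, collected in [sg], plus 2, 1, 0 or 0, 1, 2 more according to its line. The
    exponent [j.+1] removes the other forms from degree [j]. *)
Lemma special_double (s j : nat) (a : 'I_s -> nat) (n1 l ep mu : nat)
    (sg := (\sum_(i < s) (j - 1 - a i))%N) (na := #|[set i | (a i < j)%N]|) :
  (forall i, 0 < a i)%N -> (n1 <= na)%N -> (0 < mu <= j.+1)%N ->
  (j < sg + 2 * (na - n1) + l + ep * mu)%N ->
  (j <= sg + na + l + ep * (mu - 1))%N ->
  (j.-1 <= sg + 2 * n1 + l + ep * (mu - 2))%N ->
  exists c : option 'I_s -> 'I_3 -> K, c None = vec3 0 0 1 /\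
   ('C(j + 2, j) <=
    \dim (Ispace c (oapp (fun i => if a i < j then a i else j.+1) 3) j)
      + (3 * l + ep * 'C(mu - 1 + 2, mu - 1)))%N.
Proof.
move=> a0 le_n1 mu_le hA hB hC.
have sum_mem (A : {set 'I_s}) : (\sum_(i < s) ((i \in A) : nat))%N = #|A|.
  by rewrite -sum1_card [RHS]big_mkcond; apply: eq_bigr => i _; case: (i \in A).
have [S /subsetP sS cS] := exists_subset_card le_n1.
pose I : finType := ('I_s + ('I_l + 'I_ep))%type.
pose num (x : I) : nat := match x with
  | inl i => i | inr (inl k) => (s + k)%N | inr (inr k) => (s + l + k)%N end.
have num_inj : injective num.
  move=> [i|[k|k]] [i'|[k'|k']] /= e.
  - by congr inl; apply: val_inj.
  - by have := ltn_ord i; lia.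
  - by have := ltn_ord i; lia.
  - by have := ltn_ord i'; lia.
  - by congr (inr (inl _)); apply: val_inj => /=; lia.
  - by have := ltn_ord k; lia.
  - by have := ltn_ord i'; lia.
  - by have := ltn_ord k'; lia.
  - by congr (inr (inr _)); apply: val_inj => /=; lia.
pose t x : K := (num x)%:R.
have t_inj : injective t by move=> x y /(natr_inj charK0)/num_inj.
pose kd (x : I) : option bool := match x with
  | inl i => Some (i \in S) | inr (inl k) => None | inr (inr k) => Some false end.
pose m (x : I) : nat := match x with
  | inl i => (if a i < j then j.+1 - a i else 0)%N
  | inr (inl k) => 0%N | inr (inr k) => mu end.
pose c (x : option 'I_s) : 'I_3 -> K :=
  if x is Some i then vec3 1 (t (inl i)) (i \in S)%:R else vec3 0 0 1.
exists c; split=> //.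
set e := oapp _ _.
pose XL (k : 'I_l) : {vspace U j} :=
  <<[seq pw j (vec3 1 (t (inr (inl k))) z%:R) | z <- iota 0 3]>>%VS.
pose XP (k : 'I_ep) : {vspace U j} :=
  mulV (mu - 1) j (linform (vec3 1 (t (inr (inr k))) 0) ^+ (j.+1 - mu)).
pose X := (\sum_k XL k + \sum_k XP k)%VS.
have dX : (\dim X <= 3 * l + ep * 'C(mu - 1 + 2, mu - 1))%N.
  apply: leq_trans (dimv_add_leqif _ _) _; apply: leq_add.
    apply: leq_trans (dimv_leq_sum _ _ _) _.
    apply: leq_trans (_ : \sum_(k < l) 3 <= _)%N; last by rewrite sum_nat_const card_ord mulnC.
    by apply: leq_sum => k _; apply: leq_trans (dim_span _) _.
  apply: leq_trans (dimv_leq_sum _ _ _) _.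
  apply: leq_trans (_ : \sum_(k < ep) 'C(mu - 1 + 2, mu - 1) <= _)%N; last first.
    by rewrite sum_nat_const card_ord.
  by apply: leq_sum => k _; apply: dim_mulV_le.
apply: leq_trans (_ : \dim (Ispace c e j) + \dim X <= _)%N; last by rewrite leq_add2l.
rewrite -(dim_U K); apply: dim_of_killed => w wI wX.
apply: (@W_vanish K charK0 j w _ I t kd m) => //.
- move=> f hf le3; rewrite (_ : X2 K = linform (c None)).
    by apply: wI; apply: mem_Ispace.
  by rewrite linform_vec3 !scale0r scale1r !add0r.
- by case=> [i|[k|k]] //=; [case: ifP => // _; lia | lia].
- case=> [i|[k|k]] //= z [<-] m0 f; last first.
    rewrite mulr0n -subn1 => hf; apply: wX; apply: (subvP (addvSr _ _)).
    apply: (subvP (sumv_sup k isT (subvv _))).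
    by rewrite -(hprojK hf) mem_mulV.
  case: ifP m0 => // aj _; rewrite subSn ?(ltnW aj) // subSS subKn ?(ltnW aj) //= => hf.
  have := @mem_Ispace K _ c e j (Some i) f; rewrite /= aj => H; apply: wI; apply: H => //.
  exact: ltnW.
- case=> [i|[k|k]] //= _ z z3; apply: wX; apply: (subvP (addvSl _ _)).
  apply: (subvP (sumv_sup k isT (subvv _))); apply: memv_span.
  by apply/mapP; exists z; rewrite ?mem_iota.
- rewrite big_sumType /= big_sumType /= !sum_nat_const !card_ord /= muln1.
  rewrite (eq_bigr (fun i => (j - 1 - a i) + 2 * ((i \in [set i | (a i < j)%N] :\: S) : nat))%N).
    rewrite big_split /= -big_distrr /= sum_mem cardsD.
    by rewrite (setIidPr _) ?cS -/na -/sg; [lia | apply/subsetP].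
  move=> i _; rewrite /vordA !inE; have := sS i; rewrite inE.
  by case: (i \in S) => [/(_ isT) aj|_] /=; [rewrite aj; lia | case: ltnP => /= ?; lia].
- rewrite big_sumType /= big_sumType /= !sum_nat_const !card_ord /= muln1.
  rewrite (eq_bigr (fun i => (j - 1 - a i) + ((i \in [set i | (a i < j)%N]) : nat))%N).
    by rewrite big_split /= sum_mem -/na -/sg /vordB /=; lia.
  by move=> i _; rewrite /vordB !inE /=; case: ltnP => /= ?; lia.
- rewrite big_sumType /= big_sumType /= !sum_nat_const !card_ord /= muln1.
  rewrite (eq_bigr (fun i => (j - 1 - a i) + 2 * ((i \in S) : nat))%N).
    by rewrite big_split /= -big_distrr /= sum_mem cS -/sg; lia.
  move=> i _; rewrite /vordC; have := sS i; rewrite inE.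
  by case: (i \in S) => [/(_ isT) aj|_] /=; [rewrite aj; lia | case: ltnP => /= ?; lia].
Qed.

(** If all powers from a grid of [j + 1] values of t and three values of z were in [V], each of A,
    B, C would vanish at [j + 1] points for any functional killing [V]. *)
Lemma exists_power_notin j (V : {vspace U j}) :
  (forall f, f \is (j - 3).-homog -> (3 <= j)%N -> hproj j (f * X2 K ^+ 3) \in V) ->
  V <> fullv -> exists x, pw j x \notin V.
Proof.
move=> VZ Vf; have [n nV] : exists n : 'I_j.+1 * 'I_3, pw j (vec3 1 n.1%:R n.2%:R) \notin V.
  apply/existsP; apply: contraT => /existsPn nV; case: Vf.
  have inV : forall n : 'I_j.+1 * 'I_3, pw j (vec3 1 n.1%:R n.2%:R) \in V.
    by move=> n; have := nV n; rewrite negbK.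
  apply/eqP; rewrite eqEdim subvf /=.
  apply: (@leq_trans (\dim V + \dim (0%VS : {vspace U j}))%N); last by rewrite dimv0 addn0.
  apply: dim_of_killed => w wV _.
  apply: (@W_vanish K charK0 j w _ 'I_j.+1 (fun i => i%:R) (fun=> None) (fun=> 0%N)) => //.
  - by move=> f hf le3; apply: wV; apply: VZ.
  - by move=> x y /(natr_inj charK0) /val_inj.
  - by move=> i _ z z3; apply: wV; apply: (inV (i, Ordinal z3)).
  - by rewrite sum_nat_const card_ord muln1.
  - by rewrite sum_nat_const card_ord muln1.
  - by rewrite sum_nat_const card_ord muln1; lia.
by exists (vec3 1 n.1%:R n.2%:R).
Qed.

(** Each power outside the current space lowers the codimension by one. This serves the forms with
    [a i = j], which contribute a single vector in degree [j]. *)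
Lemma greedy_powers j (V : {vspace U j}) b :
  (forall f, f \is (j - 3).-homog -> (3 <= j)%N -> hproj j (f * X2 K ^+ 3) \in V) ->
  exists2 xs : seq ('I_3 -> K), size xs = b &
   ('C(j + 2, j) <= \dim (V + <<[seq pw j x | x <- xs]>>) + ('C(j + 2, j) - \dim V - b))%N.
Proof.
move=> VZ; elim: b => [|b [xs sxs le_d]].
  by exists [::] => //; rewrite span_nil addv0; have := dimvS (subvf V); rewrite dim_U; lia.
set V' := (V + _)%VS in le_d.
have [Vf|Vf] := eqVneq V' fullv.
  (* Once the space is full, a dummy form keeps the length of the list right. *)
  exists (vec3 0 0 0 :: xs); first by rewrite /= sxs.
  apply: leq_trans (leq_addr _ _); rewrite -(dim_U K) -Vf; apply: dimvS.
  by apply: addvS => //; rewrite /= span_cons addvSr.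
have [||x xV] := @exists_power_notin j V'.
- by move=> f hf le3; apply: (subvP (addvSl _ _)); apply: VZ.
- exact/eqP.
exists (x :: xs); first by rewrite /= sxs.
rewrite /= span_cons addvA [(V + _)%VS]addvC -addvA -/V'.
have dl : \dim <[pw j x]> = 1%N.
  by rewrite dim_vline; case: eqP xV => // ->; rewrite mem0v.
have := dimv_sum_cap <[pw j x]> V'; rewrite dl.
have : (\dim (<[pw j x]> :&: V') < 1)%N.
  rewrite ltnNge; apply: contra xV => le1.
  have := dimv_leqif_sup (capvSl <[pw j x]> V'); rewrite dl => -[_].
  move: le1; rewrite leq_eqVlt; have := dimvS (capvSl <[pw j x]> V'); rewrite dl.
  case: (\dim _) => [|[|?]] //= _ _ /esym; rewrite eqxx => /subvP H.
  by have := H _ (memv_line _); rewrite memv_cap => /andP[].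
have : (\dim V' < 'C(j + 2, j))%N.
  by rewrite -(dim_U K) ltnNge; apply: contraNN Vf => h; rewrite eqEdim subvf.
have arith (C v u q y : nat) : (C <= v + (C - u - b))%N -> (v < C)%N -> (y < 1)%N ->
  (q + y = 1 + v)%N -> (C <= q + (C - u - b.+1))%N by lia.
exact: arith le_d.
Qed.

(** Here [d] is what B lacks after the common zeros, and each of the [na] points supplies one. A
    remaining gap costs three conditions per zero; the tight even case costs one. *)
Definition defect (s j : nat) (a : 'I_s -> nat) : nat :=
  let d := (j - \sum_(i < s) (j - 1 - a i))%N in
  let na := #|[set i | (a i < j)%N]| in
  if (na == d) && ~~ odd na then 1%N else (3 * (d - na))%N.

Lemma special_rank (s j : nat) (a : 'I_s -> nat) :
  (forall i, 0 < a i)%N -> (0 < j)%N ->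
  exists c : option 'I_s -> 'I_3 -> K,
   ('C(j + 2, j) <= \dim (Ispace c (oapp a 3%N) j)
      + (defect j a - #|[set i | a i == j]|))%N.
Proof.
(* Only the forms with [a i < j] are placed at first; those with [a i = j] come back as greedily
   chosen powers. *)
move=> a0 j0; set e' := oapp (fun i => if a i < j then a i else j.+1)%N 3.
have [c0 [c0N le_d]] : exists c : option 'I_s -> 'I_3 -> K, c None = vec3 0 0 1 /\
   ('C(j + 2, j) <= \dim (Ispace c e' j) + defect j a)%N.
  rewrite /defect; set sg := (\sum_(i < s) _)%N; set na := #|_|.
  (* If [j - sg] is truncated to zero there is at least one point, so truncation cannot produce a
     spurious tight case. *)
  have sg0 : (j <= sg)%N -> (0 < na)%N.
    apply: contraTltn; rewrite leqn0 cards_eq0 -ltnNge => /eqP E.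
    rewrite /sg big1 // => i _; have : i \notin [set i | (a i < j)%N] by rewrite E inE.
    by rewrite inE; lia.
  have := odd_double_half na; set h := na./2 => hE.
  have := odd_double_half (j - sg); set g := (j - sg)./2 => gE.
  case: eqP => [e|ne] /=; [case: ifPn => par|].
  (* Tight even case: half of the points on each line leave A one zero short, and an extra simple
     point on z = 0 supplies it. *)
  - have [] := @special_double s j a h 0 1 1 a0; rewrite -/sg -/na; try lia.
    by move=> c [cN hc]; exists c.
  (* Tight odd case: one point more on z = 0 than on z = 1 meets all three counts exactly. *)
  - have [] := @special_double s j a g 0 0 1 a0; rewrite -/sg -/na; try lia.
    by move=> c [cN hc]; exists c; split=> //; apply: leq_trans hc _; rewrite leq_add2l ?mul0n; lia.
  - case: (ltnP na (j - sg)) => lt_d.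
      case: (boolP (odd na)) => par.
        (* Each extra triple costs three conditions and gives one zero to each of A, B, C. *)
        have [] := @special_double s j a h (j - sg - na) 0 1 a0; rewrite -/sg -/na; try lia.
        by move=> c [cN hc]; exists c; split=> //; apply: leq_trans hc _; rewrite leq_add2l ?mul0n; lia.
      (* For even [na] one triple is exchanged for a double point on z = 0: it also costs three
         conditions, but gives 2, 1, 0 zeros to A, B, C, which repairs the parity. *)
      have [] := @special_double s j a h (j - sg - na - 1) 1 2 a0; rewrite -/sg -/na; try lia.
      move=> c [cN hc]; exists c; split=> //; apply: leq_trans hc _.
      by rewrite leq_add2l (_ : 'C(2 - 1 + 2, 2 - 1) = 3%N) //; lia.
    have [] := @special_double s j a g 0 0 1 a0; rewrite -/sg -/na; try lia.
    by move=> c [cN hc]; exists c; split=> //; apply: leq_trans hc _; rewrite leq_add2l ?mul0n; lia.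
set S1 := [set i | a i == j].
have VZ f : f \is (j - 3).-homog -> (3 <= j)%N -> hproj j (f * X2 K ^+ 3) \in Ispace c0 e' j.
  move=> hf le3; rewrite (_ : X2 K = linform (c0 None)); first exact: mem_Ispace.
  by rewrite c0N linform_vec3 !scale0r scale1r !add0r.
have [xs sxs le_x] := greedy_powers #|S1| VZ.
pose c (x : option 'I_s) : 'I_3 -> K :=
  if x is Some i then
    if i \in S1 then nth (vec3 0 0 0) xs (index i (enum S1)) else c0 x
  else c0 x.
exists c; apply: leq_trans le_x _; apply: leq_add; last by lia.
apply: dimvS; rewrite subv_add; apply/andP; split.
  apply/subv_sumP => -[i|] /=; last first.
    by move=> le3; apply: (sumv_sup None).
  case: ifP => [aj _|_]; last by rewrite ltnn.
  apply: (sumv_sup (Some i)) => /=; first exact: ltnW.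
  by rewrite /S1 inE (ltn_eqF aj).
apply/span_subvP => y /(nthP 0)[n]; rewrite size_map sxs => lt_n <-.
rewrite (nth_map (vec3 0 0 0)) ?sxs //; pose i := enum_val (Ordinal lt_n).
have iS1 : i \in S1 by apply: enum_valP.
have ci : c (Some i) = nth (vec3 0 0 0) xs n.
  by rewrite /c iS1 /i (enum_val_nth i) index_uniq ?enum_uniq // -cardE.
have ai : a i = j by apply/eqP; move: iS1; rewrite inE.
rewrite -ci /pw; have := @mem_Ispace K _ c (oapp a 3%N) j (Some i) 1.
by rewrite /= ai subnn mul1r dhomog1 => /(_ isT (leqnn j)).
Qed.

End SpecialPosition.

(** * Expected dimensions *)

Lemma double_bin2 q : (2 * 'C(q + 2, q) = q.+1 * q.+2)%N.
Proof.
have -> : 'C(q + 2, q) = 'C(q.+2, 2) by rewrite -(@bin_sub q.+2 2) // addn2 !subSS subn0.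
by rewrite (mul_bin_left q.+2 1) bin1 subSS subn0.
Qed.

Section Counting.
Variables (s : nat) (a : 'I_s -> nat).

(** The dimension of the ideal in degree [q] if the powers have no syzygy there. *)
Definition expdim (q : nat) : nat := \sum_(i < s | (a i <= q)%N) 'C(q - a i + 2, q - a i).

Lemma bin2_step q : (0 < q)%N ->
  'C(q + 2, q) = ((if 3 <= q then 'C(q - 3 + 2, q - 3) else 0) + 3 * q)%N.
Proof.
have H1 := double_bin2 q; have H2 := double_bin2 (q - 3).
case: (leqP 3 q) => [le3|lt3] q0; first by nia.
by clear H1 H2; case: q q0 lt3 => [|[|[|q]]].
Qed.

Lemma expdim_step q : (0 < q)%N ->
  expdim q = ((if 3 <= q then expdim (q - 3) else 0) + 3 * \sum_(i < s) (q - 1 - a i)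
    + 3 * #|[set i | (a i < q)%N]| + #|[set i | a i == q]|)%N.
Proof.
move=> q0; have sum_mem (P : pred 'I_s) : #|[set i | P i]| = (\sum_(i < s) (P i : nat))%N.
  by rewrite -sum1_card big_mkcond; apply: eq_bigr => i _; rewrite inE; case: (P i).
have -> : (if 3 <= q then expdim (q - 3) else 0)%N
   = (\sum_(i < s) if 3 + a i <= q then 'C(q - a i - 3 + 2, q - a i - 3) else 0)%N.
  case: (leqP 3 q) => [le3|lt3].
    rewrite /expdim big_mkcond; apply: eq_bigr => i _.
    by rewrite leq_subRL // subnAC.
  by rewrite big1 // => i _; case: ifP => //; lia.
rewrite !sum_mem !big_distrr -!big_split /expdim big_mkcond; apply: eq_bigr => i _ /=.
case: (ltngtP (a i) q) => [lt|gt|e].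
- have lt' : (0 < q - a i)%N by rewrite subn_gt0.
  have -> : (3 + a i <= q)%N = (3 <= q - a i)%N by apply/idP/idP; lia.
  by rewrite /= (bin2_step lt'); case: ifP => _ /=; lia.
- by case: ifP => /=; lia.
- by rewrite e subnn bin0; case: ifP => /=; lia.
Qed.

End Counting.

(** * Injectivity and surjectivity of multiplication by [L^3] through dimensions *)

Section Quotient.
Variables (K : fieldType) (s : nat) (a : 'I_s -> nat) (c : option 'I_s -> 'I_3 -> K).
Local Notation P3 := {mpoly K[3]}.
Local Notation U := (dhomog 3 K).
Local Notation I := (Ispace (fun i => c (Some i)) a).
Local Notation J := (Ispace c (oapp a 3%N)).
Let G (i : 'I_s) := linform (c (Some i)) ^+ a i.
Let L := linform (c None).
Let M := L ^+ 3.

Lemma Ispace_mul (T : finType) (b : T -> 'I_3 -> K) e d d' j (x : U d) (f : P3) :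
  x \in Ispace b e d -> f \is d'.-homog -> (d + d')%N = j ->
  hproj j (val x * f) \in Ispace b e j.
Proof.
move=> + + <-; move=> /IspaceP[g [hg xE]] hf; apply/IspaceP; exists (fun t => g t * f); split.
  move=> t; case: (leqP (e t) d) => [le|lt]; last first.
    by rewrite (homog_of_neg _ (hg t)) ?mul0r; [apply: homog_of0 | lia].
  have -> : (d + d')%N%:Z - (e t)%:Z = (d - e t + d')%N%:Z :> int by lia.
  apply/homog_ofP; apply: dhomogM hf; apply/homog_ofP.
  by rewrite -subzn.
rewrite hprojK; last by apply: dhomogM (dhomog_is_dhomog _) hf.
by rewrite xE mulr_suml; apply: eq_bigr => t _; rewrite mulrAC.
Qed.

Lemma JspaceE j : J j = (I j + (if (3 <= j)%N then mulV (j - 3) j M else 0%VS))%VS.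
Proof.
apply/eqP; rewrite eqEsubv subv_add; apply/andP; split; last (apply/andP; split).
- apply/subv_sumP => -[i|] /= le.
    by apply: subv_trans (addvSl _ _); apply: (sumv_sup i).
  by rewrite le addvSr.
- by apply/subv_sumP => i le; apply: (sumv_sup (Some i)).
- by case: ifP => [le3|_]; [apply: (sumv_sup None) | apply: sub0v].
Qed.

Let mu q := linfun (@mulh K (q - 3) q M).

Let mu0 q x : L != 0 -> (3 <= q)%N -> mu q x = 0 -> x = 0.
Proof.
move=> L0 le3; rewrite lfunE.
by apply: (mulh_inj (expf_neq0 3 L0) (linform_exp_homog (c None) 3)); rewrite subnK.
Qed.

Let dim_mu q : L != 0 -> (3 <= q)%N -> \dim (mu q @: I (q - 3)) = \dim (I (q - 3)).
Proof.
move=> L0 le3; apply: limg_dim_eq; apply/eqP; rewrite -subv0; apply/subvP => x.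
by rewrite memv_cap memv_ker memv0 => /andP[_ /eqP/(mu0 L0 le3) ->].
Qed.

Let sub_mu q : (3 <= q)%N -> (mu q @: I (q - 3) <= I q :&: mulV (q - 3) q M)%VS.
Proof.
move=> le3; apply/subvP => _ /memv_imgP[x xI ->]; rewrite memv_cap lfunE mem_mulV andbT.
by apply: Ispace_mul xI (linform_exp_homog (c None) 3) _; rewrite subnK.
Qed.

Let dim_J q : L != 0 -> (3 <= q)%N ->
  (\dim (J q) + \dim (I q :&: mulV (q - 3) q M) = \dim (I q) + 'C(q - 3 + 2, q - 3))%N.
Proof.
move=> L0 le3; have := JspaceE q; rewrite le3 => ->; rewrite dimv_sum_cap; congr addn.
by rewrite (dim_mulV (e := 3)) ?expf_neq0 ?linform_exp_homog ?subnK.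
Qed.

Lemma dim_Jspace_le q : L != 0 -> (3 <= q)%N ->
  (\dim (J q) + \dim (I (q - 3)) <= \dim (I q) + 'C(q - 3 + 2, q - 3))%N.
Proof.
by move=> L0 le3; rewrite -(dim_J L0 le3) leq_add2l -(dim_mu L0 le3); apply: dimvS; apply: sub_mu.
Qed.

(** [M] times [I (q - 3)] always lies in [I q] intersected with the multiples of [M]. Injectivity
    modulo the ideal means equality of these two spaces, hence the inequality opposite to
    [dim_Jspace_le]. *)
Lemma injectiveP_dim q : L != 0 -> (3 <= q)%N ->
  (forall f : U (q - 3), hproj q (val f * M) \in I q -> f \in I (q - 3)) <->
  (\dim (I q) + 'C(q - 3 + 2, q - 3) <= \dim (J q) + \dim (I (q - 3)))%N.
Proof.
move=> L0 le3; rewrite -(dim_J L0 le3) leq_add2l -(dim_mu L0 le3); split=> [inj|le f fM].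
  apply: dimvS; apply/subvP => x /memv_capP[xI /mulVP[f xE]].
  rewrite xE -[hproj _ _]/(mulh q M f) -lfunE memv_img // inj //.
  by rewrite -xE.
have : mu q f \in (mu q @: I (q - 3))%VS.
  have /eqP -> : (mu q @: I (q - 3) == I q :&: mulV (q - 3) q M)%VS.
    by rewrite eqEdim sub_mu.
  by rewrite memv_cap lfunE fM mem_mulV.
case/memv_imgP => x xI /eqP; rewrite -subr_eq0 -linearB => /eqP/(mu0 L0 le3)/eqP.
by rewrite subr_eq0 => /eqP ->.
Qed.

Lemma ideal_partP j (f : P3) :
  ideal_part G a j%:Z f <-> exists2 x, x \in I j & f = val x.
Proof.
split=> [[g [hg fE]]|[x /IspaceP[g [hg xE]] ->]]; last by exists g.
have hf : f \is j.-homog.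
  rewrite fE; apply: rpred_sum => t _.
  case: (leqP (a t) j) => [le_ej|lt_je]; last first.
    by rewrite (homog_of_neg _ (hg t)) ?mul0r ?dhomog0 //; lia.
  have hg' : g t \is (j - a t).-homog by apply/homog_ofP; rewrite -subzn.
  by have := dhomogM hg' (linform_exp_homog (c (Some t)) (a t)); rewrite subnK.
exists (hproj j f); last by rewrite hprojK.
by apply/IspaceP; exists g; rewrite hprojK.
Qed.

Lemma ideal_part_hproj j (f : P3) : f \is j.-homog ->
  ideal_part G a j%:Z f <-> hproj j f \in I j.
Proof.
move=> hf; rewrite ideal_partP; split=> [[x xI ->]|fI]; first by rewrite hproj_val.
by exists (hproj j f) => //; rewrite hprojK.
Qed.

Lemma ideal_part0 d : ideal_part G a d 0.
Proof.
exists (fun=> 0); split=> [i|]; first exact: homog_of0.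
by rewrite big1 // => i _; rewrite mul0r.
Qed.

Lemma mult_injectiveP j : (3 <= j)%N ->
  mult_injective G a M j%:Z <->
  (forall f : U (j - 3), hproj j (val f * M) \in I j -> f \in I (j - 3)).
Proof.
move=> le3; rewrite /mult_injective -[3 : int]/(3%N%:Z) subzn //.
have hfM (f : P3) : f \is (j - 3).-homog -> M * f \is j.-homog.
  by move=> hf; have := dhomogM (linform_exp_homog (c None) 3) hf; rewrite subnKC.
split=> [inj f fM|inj f /homog_ofP hf].
  have hf := dhomog_is_dhomog f.
  rewrite -(hproj_val f); apply/(ideal_part_hproj hf); apply: inj; first exact/homog_ofP.
  by apply/(ideal_part_hproj (hfM _ hf)); rewrite mulrC.
move=> /(ideal_part_hproj (hfM _ hf)) fM; apply/(ideal_part_hproj hf); apply: inj.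
by rewrite hprojK // mulrC.
Qed.

Lemma mult_injective_small (j : int) : j < 3 -> mult_injective G a M j.
Proof.
move=> lt3 f hf _; rewrite (homog_of_neg _ hf); last by lia.
exact: ideal_part0.
Qed.

Lemma mult_imageP j (h : P3) : h \is j.-homog ->
  mult_image_plus_ideal G a M j%:Z h <-> hproj j h \in J j.
Proof.
move=> hh; rewrite JspaceE /mult_image_plus_ideal; case: ifP => [le3|lt3].
  have hfM (f : P3) : f \is (j - 3).-homog -> M * f \is j.-homog.
    by move=> hf; have := dhomogM (linform_exp_homog (c None) 3) hf; rewrite subnKC.
  rewrite -[3 : int]/(3%N%:Z) subzn //; split=> [[f [/homog_ofP hf hI]]|].
    move: hI => /(ideal_part_hproj (rpredB hh (hfM _ hf))) hI.
    rewrite -(subrK (M * f) h) linearD memv_add // mulrC -(hprojK hf).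
    exact: mem_mulV.
  case/memv_addP => x xI [_ /mulVP[f ->] hE]; exists (val f).
  have hf := dhomog_is_dhomog f; split; first exact/homog_ofP.
  apply/(ideal_part_hproj (rpredB hh (hfM _ hf))).
  by rewrite linearB /= hE mulrC addrK.
rewrite addv0; split=> [[f [hf]]|hI].
  rewrite (homog_of_neg _ hf) ?mulr0 ?subr0; last by lia.
  by move/(ideal_part_hproj hh).
exists 0; split; first exact: homog_of0.
by rewrite mulr0 subr0; apply/(ideal_part_hproj hh).
Qed.

Lemma mult_surjectiveP j : mult_surjective G a M j%:Z <-> J j = fullv.
Proof.
split=> [sj|Jf h /homog_ofP hh]; last by apply/(mult_imageP hh); rewrite Jf memvf.
apply/vspaceP => x; rewrite memvf -(hproj_val x).
have hx := dhomog_is_dhomog x.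
by apply/(mult_imageP hx); apply: sj; apply/homog_ofP.
Qed.

Lemma quot_dim_of_vspace j (S : {vspace U j}) (W : P3 -> Prop) :
  (forall f : P3, f \is j.-homog -> W f <-> hproj j f \in S) ->
  quot_dim (homog_of j%:Z) W ('C(j + 2, j) - \dim S).
Proof.
move=> WS; rewrite -(dim_U K) -dimv_compl.
pose X := vbasis (S^C)%VS; exists (fun k => val X`_k).
have hX k : val X`_k \is j.-homog by apply: dhomog_is_dhomog.
have hsum (d : 'I_(\dim S^C) -> K) : \sum_k d k *: val X`_k \is j.-homog.
  by apply: rpred_sum => k _; apply: rpredZ.
have psum (d : 'I_(\dim S^C) -> K) :
    hproj j (\sum_k d k *: val X`_k) = \sum_k d k *: X`_k.
  by rewrite linear_sum; apply: eq_bigr => k _; rewrite linearZ /= hproj_val.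
split=> [k|]; first exact/homog_ofP.
split=> [f /homog_ofP hf|d].
  have : hproj j f \in (S + S^C)%VS by rewrite addv_complf memvf.
  case/memv_addP => x xS [y yS fE]; exists (fun k => coord X k y).
  apply/(WS _ (rpredB hf (hsum _))); rewrite linearB /= psum.
  by rewrite -(coord_vbasis yS) fE addrK.
move/(WS _ (hsum _)); rewrite psum => dS k.
have : \sum_k d k *: X`_k \in (S :&: S^C)%VS.
  rewrite memv_cap dS; apply: memv_suml => i _; apply: memvZ; apply: vbasis_mem.
  by apply: mem_nth; rewrite size_tuple.
rewrite capv_compl memv0 => /eqP d0.
by have /freeP := basis_free (vbasisP (S^C)%VS); apply.
Qed.

(** A monomial of degree [j + 1] is a variable times one of degree [j]. Thus one generic condition
    settles all higher degrees. *)
Lemma Jspace_full_S j : J j = fullv -> J j.+1 = fullv.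
Proof.
move=> Jf; apply/vspaceP => x; rewrite memvf -(hproj_val x) [val x]mpolyE linear_sum big_seq.
apply: memv_suml => m mx; rewrite linearZ memvZ //.
have mj : mdeg m = j.+1 by have /dhomogP/(_ m mx) := dhomog_is_dhomog x.
have [k mk] : exists k, (0 < m k)%N.
  apply/existsP; apply: contraT => /existsPn m0.
  move: mj; rewrite mdegE big1 // => k _; have := m0 k; lia.
have mE : m = (m - U_(k) + U_(k))%MM by rewrite submK // lep1mP -lt0n.
rewrite mE mpolyXD.
have hm : ('X_[m - U_(k)] : P3) \is j.-homog.
  by rewrite dhomogX /=; move: mj; rewrite {1}mE mdegD mdeg1 addn1 => -[->].
rewrite -(hprojK hm); apply: Ispace_mul (var_homog _ _) (addn1 j).
by rewrite Jf memvf.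
Qed.

End Quotient.

(** * Directional derivatives of forms *)

Section DirectionalDerivative.
Variable K : fieldType.
Local Notation P3 := {mpoly K[3]}.
Implicit Types (u c : 'I_3 -> K) (p q : P3).

Definition dirder u p : P3 := \sum_(k < 3) u k *: p^`M(k).
Definition dot u c : K := \sum_(k < 3) u k * c k.

Lemma dirder_is_linear u : linear (dirder u).
Proof.
move=> x p q; rewrite /dirder scaler_sumr -big_split; apply: eq_bigr => k _ /=.
by rewrite mderivD mderivZ scalerDr !scalerA mulrC.
Qed.

HB.instance Definition _ u :=
  GRing.isLinear.Build K P3 P3 _ (dirder u) (@dirder_is_linear u).

Lemma dirderM u p q : dirder u (p * q) = dirder u p * q + p * dirder u q.
Proof.
rewrite /dirder mulr_suml mulr_sumr -big_split; apply: eq_bigr => k _ /=.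
by rewrite mderivM scalerDr scalerAl scalerAr.
Qed.

Lemma dirder_linform u c : dirder u (linform c) = (dot u c)%:MP.
Proof.
rewrite /dirder /dot raddf_sum; apply: eq_bigr => k _ /=.
have -> : (linform c)^`M(k) = (c k)%:MP; last by rewrite mpolyCM mul_mpolyC.
rewrite /linform (raddf_sum (mderiv k)) (bigD1 k) //= big1 ?addr0 => [|l ne].
  rewrite mderivZ; have -> : 'X_k^`M(k) = 1 :> P3.
    by rewrite mderivX mnm1E eqxx scale1r -mpolyX0; congr 'X_[_]; apply/mnmP => i; rewrite mnmBE subnn mnm0E.
  by rewrite -mul_mpolyC mulr1.
by rewrite mderivZ mderivX mnm1E (negPf ne) scale0r scaler0.
Qed.

Lemma dirder_exp u p e : dirder u (p ^+ e.+1) = e.+1%:R *: (p ^+ e * dirder u p).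
Proof.
elim: e => [|e IH]; first by rewrite expr1 mul1r scale1r.
rewrite exprS dirderM IH -scalerAr mulrA -exprS [dirder u p * _]mulrC.
by rewrite !scaler_nat [RHS]mulrS.
Qed.

Lemma mderiv_homog k d p : p \is d.+1.-homog -> p^`M(k) \is d.-homog.
Proof.
move/dhomogP => hp; apply/dhomogP => m; rewrite mcoeff_msupp mcoeff_deriv => nz.
have : (m + U_(k))%MM \in msupp p.
  by rewrite mcoeff_msupp; apply: contraNneq nz => ->; rewrite mul0rn.
by move/hp; rewrite /= mdegD mdeg1 addn1 => -[].
Qed.

Lemma dirder_homog u d p : p \is d.+1.-homog -> dirder u p \is d.-homog.
Proof. by move=> hp; apply: rpred_sum => k _; apply: rpredZ; apply: mderiv_homog. Qed.

Lemma homog0_const p : p \is 0.-homog -> p = (p@_0%MM)%:MP.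
Proof.
move/dhomogP => hp; apply/mpolyP => m; rewrite mcoeffC.
case: eqP => [->|/eqP m0]; first by rewrite mulr1.
rewrite mulr0; apply/memN_msupp_eq0; apply: contraNN m0 => /hp /= m0.
by rewrite -mdeg_eq0 m0.
Qed.

Lemma dirder_homog0 u p : p \is 0.-homog -> dirder u p = 0.
Proof.
move/homog0_const => ->; apply: big1 => k _; by rewrite mderivC scaler0.
Qed.

End DirectionalDerivative.

(** * Powers of linear forms without syzygies in a given degree *)

Section Syzygies.
Variables (K : fieldType) (charK0 : [pchar K] =i pred0).
Local Notation P3 := {mpoly K[3]}.

(** Differentiating gives the same equation for [dirder u g] with [e] raised by one, so
    [dirder u g = 0] by induction on the degree; then a nonzero multiple of [g] is zero. *)
Lemma euler_ode u (L : P3) (lam : K) d e (g : P3) :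
  dirder u L = lam%:MP -> lam != 0 -> g \is d.-homog ->
  dirder u g * L + (e.+1%:R * lam) *: g = 0 -> g = 0.
Proof.
move=> DL lam0; have fin (f : P3) e' : (e'.+1%:R * lam) *: f = 0 -> f = 0.
  move/eqP; rewrite mscalerI mulf_eq0 (negPf lam0) orbF.
  by rewrite (negPf (natr_neq0 charK0 (ltn0Sn e'))) => /eqP.
elim: d g e => [|d IH] g e hg eq0.
  by apply: (fin _ e); move: eq0; rewrite (dirder_homog0 u hg) mul0r add0r.
have Dg0 : dirder u g = 0.
  apply: (IH _ e.+1); first exact: dirder_homog.
  have : dirder u (dirder u g * L + (e.+1%:R * lam) *: g) = 0 by rewrite eq0 linear0.
  rewrite linearD /= dirderM DL linearZ /= => <-; rewrite -addrA; congr (_ + _).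
  rewrite [_ * lam%:MP]mulrC mul_mpolyC -scalerDl; congr (_ *: _).
  by rewrite -[in LHS]add1n natrD mulrDl mul1r.
by apply: (fin _ e); move: eq0; rewrite Dg0 mul0r add0r.
Qed.

(** Degree [m - 1], where [m = 0] forces [g = 0]. With [m = N.+1 - a] this is the degree of the
    coefficient of an [a]-th power in degree [N], including [a > N]; [m] is also the multiplicity of
    the dual fat point. *)
Definition homog_pred (m : nat) (g : P3) := forall mu, mu \in msupp g -> (mdeg mu).+1 = m.

Lemma homog_predP d g : homog_pred d.+1 g <-> g \is d.-homog.
Proof.
split=> [h|/dhomogP h mu mug]; last by rewrite h.
by apply/dhomogP => mu /h [].
Qed.

Lemma homog_pred0 g : homog_pred 0 g -> g = 0.
Proof. by move=> h; apply/mpolyP => m; rewrite mcoeff0; apply/memN_msupp_eq0/negP => /h. Qed.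

Lemma homog_pred_zero m : homog_pred m 0.
Proof. by move=> mu; rewrite msupp0. Qed.

Lemma dirder_homog_pred u m g : homog_pred m g -> homog_pred (m - 1) (dirder u g).
Proof.
case: m => [|[|m]].
- by move/homog_pred0 ->; rewrite linear0; apply: homog_pred_zero.
- by move/homog_predP/dirder_homog0 ->; apply: homog_pred_zero.
by move/homog_predP => hg; rewrite subn1; apply/homog_predP; apply: dirder_homog.
Qed.

Variables (s : nat) (c : 'I_s -> 'I_3 -> K).
Local Notation L i := (linform (c i)).

Definition no_syzygy (N : nat) (m : 'I_s -> nat) :=
  forall g : 'I_s -> P3, (forall i, homog_pred (m i) (g i)) ->
  \sum_i g i * L i ^+ (N.+1 - m i) = 0 -> forall i, g i = 0.

Lemma no_syzygy_eq N m m' : m =1 m' -> no_syzygy N m -> no_syzygy N m'.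
Proof.
move=> mm' ns g hg g0; apply: ns => [i|]; first by rewrite mm'.
by rewrite -[RHS]g0; apply: eq_bigr => i _; rewrite mm'.
Qed.

(** Dual to splitting off a line from fat points. Differentiating a syzygy along [u] lowers the
    total degree by one. On the line the coefficient loses a degree; off the line it becomes
    [dirder u g * L] plus a nonzero multiple of [g], which by [euler_ode] vanishes only with [g].
    What survives is a syzygy supported on the line. *)
Lemma no_syzygy_derive u (Z : pred 'I_s) N m :
  (forall i, (0 < m i)%N -> Z i = (dot u (c i) == 0)) ->
  (forall i, ~~ Z i -> m i <= N.+1)%N ->
  no_syzygy N (fun i => m i - Z i)%N ->
  no_syzygy N.+1 (fun i => if Z i then m i else 0%N) ->
  no_syzygy N.+1 m.
Proof.
move=> hZ hm ns1 ns2 g hg g0.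
pose g' i := if Z i then dirder u (g i)
  else dirder u (g i) * L i + ((N.+1 - m i).+1%:R * dot u (c i)) *: g i.
have hg' i : homog_pred (m i - Z i) (g' i).
  rewrite /g'; case: (Z i); first exact: dirder_homog_pred.
  rewrite subn0; have := hg i; case: (m i) => [|[|d]].
  - by move/homog_pred0 ->; rewrite linear0 mul0r scaler0 add0r; apply: homog_pred_zero.
  - move/homog_predP => h; apply/homog_predP.
    by rewrite dirder_homog0 // mul0r add0r; apply: rpredZ.
  move/homog_predP => h; apply/homog_predP; rewrite rpredD ?rpredZ //.
  by have := dhomogM (dirder_homog u h) (linform_homog (c i)); rewrite addn1.
have g'0 : forall i, g' i = 0.
  apply: ns1 => //.
  transitivity (dirder u (\sum_i g i * L i ^+ (N.+2 - m i))); last by rewrite g0 linear0.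
  rewrite (raddf_sum (dirder u)); apply: eq_bigr => i _ /=.
  case: (posnP (m i)) => [m0|m0].
    have := hg i; rewrite m0 => /homog_pred0 gi0; rewrite /g' gi0.
    by case: (Z i); rewrite !linear0 ?mul0r ?scaler0 ?addr0 ?mul0r linear0.
  rewrite dirderM /g'; case: ifP => Zi.
    rewrite (_ : N.+2 - m i = (N.+1 - (m i - 1)))%N; last by lia.
    have DL0 : dirder u (L i) = 0.
      by rewrite dirder_linform; have := hZ i m0; rewrite Zi => /esym/eqP ->.
    case: (N.+1 - (m i - 1))%N => [|e]; last by rewrite dirder_exp DL0 !mulr0 scaler0 mulr0 addr0.
    by rewrite expr0 (dirder_homog0 u (dhomog1 _ _)) mulr0 addr0.
  have := hm i (negbT Zi) => le_m.
  rewrite subn0 (subSn le_m) dirder_exp dirder_linform mulrDl exprS mulrA; congr (_ + _).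
  rewrite -!mul_mpolyC !mpolyCM; ring.
have gZ i : ~~ Z i -> g i = 0.
  move=> Zi; case: (posnP (m i)) => [m0|m0].
    by apply: homog_pred0; rewrite -m0.
  have hgi : g i \is (m i).-1.-homog by apply/homog_predP; rewrite prednK.
  apply: (euler_ode (dirder_linform u (c i)) _ hgi (e := (N.+1 - m i)%N)).
    by rewrite -(hZ i m0).
  by have := g'0 i; rewrite /g' (negPf Zi).
apply: ns2 => [i|]; first by case: ifPn => // /gZ ->; apply: homog_pred_zero.
rewrite -[RHS]g0; apply: eq_bigr => i _; case: ifPn => // /gZ ->.
by rewrite !mul0r.
Qed.

Lemma no_syzygy_single N m i : L i != 0 -> (forall l, l != i -> m l = 0%N) -> no_syzygy N m.
Proof.
move=> Li m0 g hg g0; have gl l : l != i -> g l = 0.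
  by move=> /m0 ml; apply: homog_pred0; rewrite -ml.
move=> l; have [->|/gl //] := eqVneq l i.
move: g0; rewrite (bigD1 i) //= big1 ?addr0 => [/eqP|k /gl ->]; last by rewrite mul0r.
by rewrite mulf_eq0 expf_eq0 (negPf Li) andbF orbF => /eqP.
Qed.

Lemma no_syzygy_zero N m : (forall i, m i = 0%N) -> no_syzygy N m.
Proof. by move=> m0 g hg _ i; apply: homog_pred0; rewrite -(m0 i). Qed.

Definition separated (A : {set 'I_s}) :=
  forall i, i \in A -> L i != 0 /\ exists u, forall l, l \in A -> (dot u (c l) == 0) = (l == i).

(** A line through exactly one point of [A] lowers both the degree and the sum of the multiplicities
    by one; in degree 0 at most one power is left. *)
Lemma no_syzygy_separated (A : {set 'I_s}) N m : separated A ->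
  (forall i, i \notin A -> m i = 0%N) -> (\sum_i m i <= N.+1)%N -> no_syzygy N m.
Proof.
move=> sepA; elim: N m => [|N IH] m mA le_m.
  case: (pickP (fun i => 0 < m i)%N) => [i mi|m0]; last first.
    by apply: no_syzygy_zero => i; have := m0 i; lia.
  have iA : i \in A by apply: contraLR mi => /mA ->.
  apply: (no_syzygy_single (i := i)); first by case: (sepA i iA).
  move=> l ne; move: le_m; rewrite (bigD1 i) //= (bigD1 l) //=; lia.
case: (pickP (fun i => 0 < m i)%N) => [i mi|m0]; last first.
  by apply: no_syzygy_zero => i; have := m0 i; lia.
have iA : i \in A by apply: contraLR mi => /mA ->.
have [Li [u hu]] := sepA i iA.
apply: (no_syzygy_derive (u := u) (Z := pred1 i)).
- move=> l ml; rewrite hu //; by apply: contraLR ml => /mA ->.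
- move=> l /= ne; move: le_m; rewrite (bigD1 i) //= (bigD1 l) //=; lia.
- apply: IH => [l /mA -> //|]; move: le_m; rewrite (bigD1 i) //= => le_m.
  rewrite (bigD1 i) //= eqxx (eq_bigr m) /=; last by move=> l /negPf ->; rewrite subn0.
  by lia.
by apply: (no_syzygy_single (i := i)) => // l /negPf /= ->.
Qed.

Section TwoLines.
Variables (A B : {set 'I_s}) (h : nat).
Hypotheses (AB : [disjoint A & B]) (cA : #|A| = h) (cB : #|B| = h) (h2 : (2 <= h)%N).
Hypothesis sepAB : separated (A :|: B).
Variables (u1 u2 : 'I_3 -> K).
Hypothesis hu1 : forall l, l \in A :|: B -> (dot u1 (c l) == 0) = (l \in A).
Hypothesis hu2 : forall l, l \in A :|: B -> (dot u2 (c l) == 0) = (l \in B).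

Let mm x y (i : 'I_s) : nat := if i \in A then x else if i \in B then y else 0%N.

Let mmN x y i : i \notin A :|: B -> mm x y i = 0%N.
Proof. by rewrite inE negb_or /mm => /andP[/negPf -> /negPf ->]. Qed.

Let sum_mm x y : (\sum_i mm x y i = x * h + y * h)%N.
Proof.
rewrite (bigID (fun i => i \in A)) /= (eq_bigr (fun=> x)) => [|i iA]; last by rewrite /mm iA.
rewrite sum_nat_const cA [(h * x)%N]mulnC; congr (_ + _)%N.
rewrite (bigID (fun i => i \in B)) /= addnC big1 => [|i /andP[/negPf iA /negPf iB]]; last first.
  by rewrite /mm iA iB.
rewrite add0n (eq_bigl (fun i => i \in B)) => [|i]; last first.
  by rewrite /= andb_idl // => iB; apply: contraL iB => iA; rewrite (disjointFr AB iA).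
rewrite (eq_bigr (fun=> y)) ?sum_nat_const ?cB ?[(h * y)%N]mulnC // => i iB.
by rewrite /mm iB (disjointFl AB iB).
Qed.

(** The total multiplicity [4 h] is too large for [no_syzygy_separated]. Splitting off the lines of
    [A], [B], [A] in turn takes the multiplicities (2, 2) to (1, 2), (1, 1), (0, 1), and the part
    supported on one line is small enough each time. *)
Lemma no_syzygy_two_lines : no_syzygy (2 * h) (mm 2 2).
Proof.
have sep N x y : (x * h + y * h <= N.+1)%N -> no_syzygy N (mm x y).
  by move=> le; apply: (no_syzygy_separated sepAB); [apply: mmN | rewrite sum_mm].
have mem_mm x y l : (0 < mm x y l)%N -> l \in A :|: B.
  by apply: contraLR => /mmN ->.
have mA x y : (fun i => if i \in A then mm x y i else 0%N) =1 mm x 0.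
  by move=> i; rewrite /mm; case: (i \in A) => //; case: (i \in B).
have mB x y : (fun i => if i \in B then mm x y i else 0%N) =1 mm 0 y.
  move=> i; rewrite /mm; case: (boolP (i \in A)) => [iA|_]; last by case: (i \in B).
  by rewrite (disjointFr AB iA).
have mA1 x y : (fun i => mm x y i - (i \in A))%N =1 mm (x - 1) y.
  by move=> i; rewrite /mm; case: (i \in A) => //; rewrite subn0.
have mB1 x y : (fun i => mm x y i - (i \in B))%N =1 mm x (y - 1).
  move=> i; rewrite /mm; case: (boolP (i \in A)) => [iA|_].
    by rewrite (disjointFr AB iA) subn0.
  by case: (i \in B).
have le_mm x y N l : (x <= N)%N -> (y <= N)%N -> (mm x y l <= N)%N.
  by move=> hx hy; rewrite /mm; do 2?case: ifP.
have stepA N x y : (x <= N.+1)%N -> (y <= N.+1)%N -> no_syzygy N (mm (x - 1) y) ->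
    no_syzygy N.+1 (mm x 0) -> no_syzygy N.+1 (mm x y).
  move=> hx hy n1 n2; apply: (no_syzygy_derive (u := u1) (Z := fun i => i \in A)).
  - by move=> i /mem_mm /hu1 ->.
  - by move=> i _; apply: le_mm.
  - by apply: no_syzygy_eq n1 => i; rewrite -mA1.
  - by apply: no_syzygy_eq n2 => i; rewrite -(mA x y).
have stepB N x y : (x <= N.+1)%N -> (y <= N.+1)%N -> no_syzygy N (mm x (y - 1)) ->
    no_syzygy N.+1 (mm 0 y) -> no_syzygy N.+1 (mm x y).
  move=> hx hy n1 n2; apply: (no_syzygy_derive (u := u2) (Z := fun i => i \in B)).
  - by move=> i /mem_mm /hu2 ->.
  - by move=> i _; apply: le_mm.
  - by apply: no_syzygy_eq n1 => i; rewrite -mB1.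
  - by apply: no_syzygy_eq n2 => i; rewrite -(mB x y).
have [k hk] : exists k, (2 * h = k.+3)%N by exists (2 * h - 3)%N; lia.
rewrite hk; apply: (stepA _ 2 2); [lia | lia | | by apply: sep; lia].
apply: stepB; [lia | lia | | by apply: sep; lia].
apply: stepA; [lia | lia | | by apply: sep; lia].
(* Simple points on the line of [B] remain in degree [2 h - 3], and [h <= 2 h - 2] because
   [2 <= h]. *)
by apply: sep; lia.
Qed.

(** A line through a single point lowers one multiplicity and the degree by one; this is repeated
    until all multiplicities are 2. *)
Lemma no_syzygy_lift N m : (forall i, i \in A :|: B -> 2 <= m i)%N ->
  (forall i, i \notin A :|: B -> m i = 0%N) ->
  (\sum_(i in A :|: B) (m i - 2) + 2 * h = N)%N -> no_syzygy N m.
Proof.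
move=> m2 m0 <-.
have [k Ek] : exists k, k = (\sum_(i in A :|: B) (m i - 2))%N by eexists.
rewrite -Ek; elim: k => [|k IH] in m m2 m0 Ek *.
  rewrite add0n; apply: no_syzygy_eq no_syzygy_two_lines => i.
  case: (boolP (i \in A :|: B)) => [iAB|iAB]; last by rewrite mmN ?m0.
  have -> : m i = 2%N.
    move/esym/eqP: Ek; rewrite sum_nat_eq0 => /forallP/(_ i)/implyP/(_ iAB)/eqP.
    by have := m2 i iAB; lia.
  by move: iAB; rewrite inE /mm; case: (i \in A) => //= ->.
have [i iAB mi] : exists2 i, i \in A :|: B & (0 < m i - 2)%N.
  apply/exists_inP; apply: contraT; rewrite negb_exists_in => /forall_inP H.
  by move: Ek; rewrite big1 // => i /H; lia.
have [Li [u hu]] := sepAB iAB; rewrite addSn.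
move: Ek; rewrite (bigD1 i) //= => Ek.
apply: (no_syzygy_derive (u := u) (Z := pred1 i)).
- by move=> l ml; rewrite hu //; apply: contraLR ml => /m0 ->.
- move=> l /= ne; case: (boolP (l \in A :|: B)) => [lAB|/m0 -> //].
  by move: Ek; rewrite (bigD1 l) /= ?lAB //; lia.
- apply: IH => [l lAB|l lAB|].
  + by rewrite /=; have := m2 l lAB; case: eqP => [->|_] /=; lia.
  + by rewrite m0.
  rewrite (bigD1 i) //= eqxx (eq_bigr (fun l => m l - 2)%N) => [|l /andP[_ /negPf /= ->]]; last by rewrite subn0.
  rewrite /=; move: Ek mi; set S := (\sum_(j | _) _)%N; lia.
by apply: (no_syzygy_single (i := i)) => // l /negPf /= ->.
Qed.

End TwoLines.

Lemma expdim_no_syzygy a N : no_syzygy N (fun i => N.+1 - a i)%N ->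
  (forall i, (a i <= N)%N -> L i != 0) -> (expdim a N <= \dim (Ispace c a N))%N.
Proof.
move=> ns L0; rewrite /expdim /Ispace.
pose V i := mulV (N - a i) N (L i ^+ a i).
have -> : (\sum_(i < s | a i <= N) 'C(N - a i + 2, N - a i))%N = (\sum_(i < s | (a i <= N)%N) \dim (V i))%N.
  apply: eq_bigr => i le; rewrite (dim_mulV (e := a i)) ?subnK ?linform_exp_homog //.
  by rewrite expf_neq0 // L0.
suff /directvP -> : directv (\sum_(i < s | (a i <= N)%N) V i) by [].
apply/directv_sum_independent => us usV us0.
have /fin_all_exists[g gP] : forall i, exists g : P3, homog_pred (N.+1 - a i) g /\
   ((a i <= N)%N -> us i = hproj N (g * L i ^+ a i)).
  move=> i; case: (leqP (a i) N) => [le|lt]; last first.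
    by exists 0; split=> [|]; [apply: homog_pred_zero | lia].
  have /mulVP[f fE] := usV i le; exists (val f); split=> //.
  by rewrite subSn //; apply/homog_predP; apply: dhomog_is_dhomog.
have g0 : forall i, g i = 0.
  apply: ns => [i|]; first by case: (gP i).
  transitivity (val (\sum_(i < s | (a i <= N)%N) us i)); last by rewrite us0.
  rewrite raddf_sum [RHS]big_mkcond; apply: eq_bigr => i _ /=.
  case: (gP i) => hg ug; case: (leqP (a i) N) => [le|lt]; last first.
    have e0 : (N.+1 - a i = 0)%N by lia.
    by move: hg; rewrite e0 => /homog_pred0 ->; rewrite mul0r.
  have hx : g i * L i ^+ a i \is N.-homog.
    move: hg; rewrite subSn // => /homog_predP hg.
    by have := dhomogM hg (linform_exp_homog (c i) (a i)); rewrite subnK.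
  rewrite (ug le) [RHS](hprojK hx); congr (_ * _ ^+ _); lia.
by move=> i le; case: (gP i) => _ ->; rewrite // g0 mul0r linear0.
Qed.

End Syzygies.

(** * Apolarity and the curve that obstructs surjectivity *)

Section Apolarity.
Variables (K : fieldType) (charK0 : [pchar K] =i pred0).
Local Notation P3 := {mpoly K[3]}.
Local Notation U := (dhomog 3 K).
Implicit Types (u : 'I_3 -> K) (p q F g : P3).

Lemma msize_homog d p : p \is d.-homog -> (msize p <= d.+1)%N.
Proof.
move/dhomogP => hp; rewrite msizeE; apply/bigmax_leqP_seq => m mp _.
by rewrite (hp m mp).
Qed.

(* The apolar pairing g(d/dx) F at 0, for [g] of degree less than [b]. *)
Definition apolar b F g : K := \sum_(m : 'X_{1..3 < b}) g@_m * (F^`M[m])@_0%MM.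

Lemma apolar_is_linear b F : linear (apolar b F : P3 -> K^o).
Proof.
move=> x p q; rewrite /apolar scaler_sumr -big_split; apply: eq_bigr => m _ /=.
by rewrite mcoeffD mcoeffZ mulrDl -mulrA.
Qed.

HB.instance Definition _ b F :=
  GRing.isLinear.Build K P3 K^o _ (apolar b F) (@apolar_is_linear b F).

Lemma apolarX b F m : (mdeg m < b)%N -> apolar b F 'X_[m] = (F^`M[m])@_0%MM.
Proof.
move=> lt_m; rewrite /apolar (bigD1 (BMultinom lt_m)) //= mcoeffX eqxx mul1r.
rewrite big1 ?addr0 // => m' ne; rewrite mcoeffX; case: eqP => [e|]; last by rewrite mul0r.
by case/eqP: ne; apply: val_inj.
Qed.

Lemma apolarE b F g : (msize g <= b)%N ->
  apolar b F g = \sum_(m <- msupp g) g@_m * (F^`M[m])@_0%MM.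
Proof.
move=> le_g; rewrite {1}[g]mpolyE linear_sum big_seq [RHS]big_seq.
apply: eq_bigr => m mg; rewrite linearZ /= apolarX //.
exact: leq_trans (msize_mdeg_lt mg) le_g.
Qed.

Lemma apolar_var b F d g k : g \is d.-homog -> (d.+1 < b)%N ->
  apolar b F ('X_k * g) = apolar b F^`M(k) g.
Proof.
move=> hg db; rewrite [RHS]apolarE; last by apply: leq_trans (msize_homog hg) (ltnW db).
rewrite {1}[g]mpolyE mulr_sumr linear_sum big_seq [RHS]big_seq; apply: eq_bigr => m mg.
have md : mdeg m = d by have /dhomogP/(_ m mg) := hg.
rewrite -scalerAr linearZ /= -mpolyXD apolarX; last by rewrite mdegD mdeg1 md.
by rewrite mderivmDm mderivmU1m.
Qed.

Lemma apolar_linform b F d g u : g \is d.-homog -> (d.+1 < b)%N ->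
  apolar b F (linform u * g) = apolar b (dirder u F) g.
Proof.
move=> hg db; rewrite /linform mulr_suml linear_sum.
transitivity (\sum_(k < 3) u k * apolar b F^`M(k) g).
  apply: eq_bigr => k _; rewrite -scalerAl linearZ /=.
  by rewrite (apolar_var F k hg db).
rewrite /apolar /dirder.
under eq_bigr do rewrite mulr_sumr.
rewrite exchange_big; apply: eq_bigr => m _ /=.
rewrite (raddf_sum (mderivm m)) raddf_sum mulr_sumr; apply: eq_bigr => k _ /=.
by rewrite mderivmZ mcoeffZ mulrCA.
Qed.

Lemma apolar_linform_exp b F d g u e : g \is d.-homog -> (d + e < b)%N ->
  apolar b F (linform u ^+ e * g) = apolar b (iter e (dirder u) F) g.
Proof.
move=> hg; elim: e F => [|e IH] F db; first by rewrite mul1r.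
rewrite exprS -mulrA (@apolar_linform _ _ (e + d)); last 1 first.
- by rewrite addnC -addnS.
- by rewrite IH ?iterSr //; rewrite addnS in db; apply: ltnW.
by rewrite dhomogM // linform_exp_homog.
Qed.

(** The degree in the direction [u] is at most [N]. In characteristic zero, for a form of degree d
    this means multiplicity at least [d - N] at the point [u]. *)
Definition ndeg u p N := iter N.+1 (dirder u) p = 0.

Lemma iter_dirderD u n p q :
  iter n (dirder u) (p + q) = iter n (dirder u) p + iter n (dirder u) q.
Proof. by elim: n => //= n ->; rewrite linearD. Qed.

Lemma iter_dirder0 u n : iter n (dirder u) 0 = 0.
Proof. by elim: n => //= n ->; rewrite linear0. Qed.

Lemma ndegM u p q n1 n2 : ndeg u p n1 -> ndeg u q n2 -> ndeg u (p * q) (n1 + n2).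
Proof.
rewrite /ndeg; have [n] := ubnP (n1 + n2); elim: n => // n IH in n1 n2 p q *.
rewrite ltnS => le_n p0 q0; rewrite iterSr dirderM iter_dirderD.
have -> : iter (n1 + n2) (dirder u) (dirder u p * q) = 0.
  case: n1 => [|n1] in p0 le_n *; first by rewrite (p0 : dirder u p = 0) mul0r iter_dirder0.
  by rewrite addSn; apply: IH => //; rewrite -iterSr.
rewrite add0r; case: n2 => [|n2] in q0 le_n *; first by rewrite (q0 : dirder u q = 0) mulr0 iter_dirder0.
by rewrite addnS; apply: IH; rewrite ?addnS // -?iterSr //; lia.
Qed.

Lemma ndeg1 u : ndeg u 1 0.
Proof. by rewrite /ndeg /= dirder_homog0 // dhomog1. Qed.

Lemma ndegX u p n e : ndeg u p n -> ndeg u (p ^+ e) (e * n).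
Proof.
by move=> hp; elim: e => [|e IH]; [apply: ndeg1 | rewrite exprS mulSn; apply: ndegM].
Qed.

Lemma ndeg_prod u (I : finType) (p : I -> P3) (n : I -> nat) :
  (forall i, ndeg u (p i) (n i)) -> ndeg u (\prod_i p i) (\sum_i n i).
Proof.
move=> hp; elim: (index_enum I) => [|i r IH]; first by rewrite !big_nil; apply: ndeg1.
by rewrite !big_cons; apply: ndegM.
Qed.

Lemma ndeg_homog1 u p : p \is 1.-homog -> ndeg u p 1.
Proof. by move=> hp; rewrite /ndeg /= dirder_homog0 // dirder_homog. Qed.

Lemma iter_dirder_homog u e d p : p \is (d + e).-homog -> iter e (dirder u) p \is d.-homog.
Proof.
elim: e p => [|e IH] p hp; first by rewrite addn0 in hp.
by rewrite iterSr; apply: IH; apply: dirder_homog; rewrite -addnS.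
Qed.

Definition dmap u e d d' (f : U d) : U d' := hproj d' (iter e (dirder u) (val f)).

Lemma dmap_is_linear u e d d' : linear (@dmap u e d d').
Proof.
move=> x p q; rewrite /dmap.
have -> : iter e (dirder u) (val (x *: p + q)) =
    x *: iter e (dirder u) (val p) + iter e (dirder u) (val q).
  by elim: e => //= e ->; rewrite linearP.
by rewrite linearP.
Qed.

HB.instance Definition _ u e d d' :=
  GRing.isLinear.Build K (U d) (U d') _ (@dmap u e d d') (@dmap_is_linear u e d d').

Definition dker u e d d' : {vspace U d} := lker (linfun (@dmap u e d d')).

Lemma dkerP u e d d' (f : U d) : (d' + e)%N = d -> f \in dker u e d d' ->
  iter e (dirder u) (val f) = 0.
Proof.
move=> de; rewrite memv_ker lfunE => /eqP /(congr1 val).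
by rewrite hprojK // iter_dirder_homog // de dhomog_is_dhomog.
Qed.

Lemma dim_dker u e d d' (V : {vspace U d}) :
  (\dim V <= \dim (V :&: dker u e d d') + 'C(d' + 2, d'))%N.
Proof.
rewrite -(limg_ker_dim (linfun (@dmap u e d d')) V) leq_add2l.
by rewrite -(dim_U K); apply: dimvS; apply: subvf.
Qed.

Lemma exists_line u u' : exists l : U 1, [/\ l != 0, dirder u (val l) = 0 & dirder u' (val l) = 0].
Proof.
pose V := (dker u 1 1 0 :&: dker u' 1 1 0)%VS.
have : V != 0%VS.
  rewrite -dimv_eq0 -lt0n; have := dim_dker u 1 0 (fullv : {vspace U 1}); rewrite capfv dim_U => h1.
  have := dim_dker u' 1 0 (dker u 1 1 0); rewrite -/V; move: h1.
  by rewrite -[X in (X <= _)%N]/3%N; rewrite -['C(0 + 2, 0)]/1%N; lia.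
rewrite -vpick0 => V0; exists (vpick V).
have := memv_pick V; rewrite memv_cap => /andP[h1 h2]; split=> //.
  exact: (dkerP (e := 1) _ h1).
exact: (dkerP (e := 1) _ h2).
Qed.

(** Forms of degree [k] with multiplicity [k - 1] at [u0] make up a space of dimension at least
    ['C(k + 2, 2) - 'C(k, 2) = 2 k + 1], one more than the number of points to pass through. *)
Lemma exists_bundle_curve (T : finType) (A : {set T}) (c : T -> 'I_3 -> K) u0 k :
  (2 <= k)%N -> #|A| = (2 * k)%N ->
  exists f : U k, [/\ f != 0, ndeg u0 (val f) 1 & forall i, i \in A -> ndeg (c i) (val f) (k - 1)].
Proof.
move=> k2 cA; pose V0 := dker u0 2 k (k - 2).
have H (r : seq T) : (\dim V0 <= \dim (V0 :&: \bigcap_(i <- r) dker (c i) k k 0)%VS + size r)%N.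
  elim: r => [|i r IH]; first by rewrite big_nil capvf addn0.
  rewrite big_cons /= capvA [(V0 :&: _)%VS]capvC -capvA [(dker _ _ _ _ :&: _)%VS]capvC.
  have := dim_dker (c i) k 0 (V0 :&: \bigcap_(i <- r) dker (c i) k k 0)%VS.
  by rewrite -['C(0 + 2, 0)]/1%N; lia.
pose V := (V0 :&: \bigcap_(i <- enum A) dker (c i) k k 0)%VS.
have : V != 0%VS.
  rewrite -dimv_eq0 -lt0n; have := H (enum A); rewrite -cardE cA -/V.
  have := dim_dker u0 2 (k - 2) (fullv : {vspace U k}); rewrite capfv dim_U -/V0.
  have := double_bin2 k; have := double_bin2 (k - 2).
  have arith X Y dv dV : (2 * X = (k - 2).+1 * (k - 2).+2 -> 2 * Y = k.+1 * k.+2 ->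
      Y <= dv + X -> dv <= dV + 2 * k -> 0 < dV)%N.
    have [k' ->] : exists k', k = k'.+2 by exists (k - 2)%N; lia.
    by rewrite -(addn2 k') addnK; nia.
  exact: arith.
rewrite -vpick0 => V0'; exists (vpick V).
have := memv_pick V; rewrite memv_cap => /andP[h0 hA]; split=> //.
  by apply: (dkerP (e := 2) _ h0); lia.
move=> i iA; rewrite /ndeg (_ : (k - 1).+1 = k); last by lia.
apply: (dkerP (d' := 0) (add0n k)).
by move: hA; rewrite big_enum; apply/subvP; apply: (bigcapv_inf i iA (subvv _)).
Qed.

(** Pairing with the equation [F] of the curve is a functional that kills all multiples of the
    powers, because enough derivatives of [F] in the corresponding directions vanish. No generality
    of the forms enters. *)
Lemma Jspace_not_full (s j k : nat) (a : 'I_s -> nat) (c : option 'I_s -> 'I_3 -> K) :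
  (forall i, 0 < a i)%N -> (2 <= k)%N -> #|[set i | (a i < j)%N]| = (2 * k)%N ->
  (\sum_(i < s) (j - 1 - a i) + 2 * k = j)%N -> (forall i, a i <> j) ->
  Ispace c (oapp a 3%N) j <> fullv.
Proof.
move=> a0 k2 cA sumj aj Jf.
have [f [f0 fP fA]] := exists_bundle_curve (fun i => c (Some i)) (c None) k2 cA.
have /fin_all_exists[l lP] : forall i : 'I_s, exists l : U 1,
    [/\ l != 0, dirder (c (Some i)) (val l) = 0 & dirder (c None) (val l) = 0].
  by move=> i; apply: exists_line.
have hl i : val (l i) \is 1.-homog by apply: dhomog_is_dhomog.
pose R := \prod_(i < s) val (l i) ^+ (j - 1 - a i).
pose F := val f ^+ 2 * R.
have val0 d (x : U d) : x != 0 -> val x != 0.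
  by apply: contraNneq => x0; apply/eqP/val_inj.
have F0 : F != 0.
  apply: mulf_neq0; first by apply: expf_neq0; apply: val0.
  by apply/prodf_neq0 => i _; apply: expf_neq0; apply: val0; case: (lP i).
have hF : F \is j.-homog.
  have h1 := dhomogMn 2 (dhomog_is_dhomog f).
  have h2 : R \is (\sum_(i < s) (j - 1 - a i)).-homog.
    rewrite /R; elim: (index_enum _) => [|i r IH]; first by rewrite !big_nil dhomog1.
    by rewrite !big_cons dhomogM // exp_homog.
  by have := dhomogM h1 h2; rewrite addnC mulnC sumj.
have DP : iter 3 (dirder (c None)) F = 0.
  have hR : ndeg (c None) R (\sum_(i < s) 0).
    apply: ndeg_prod => i; have [_ _ h] := lP i.
    by have := @ndegX _ _ 0 (j - 1 - a i) h; rewrite muln0.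
  by have := ndegM (ndegX 2 fP) hR; rewrite sum_nat_const muln0.
have DA i : (a i < j)%N -> iter (a i) (dirder (c (Some i))) F = 0.
  move=> lt_i; have iA : i \in [set i | (a i < j)%N] by rewrite inE.
  have hR : ndeg (c (Some i)) R (\sum_(l < s) if l == i then 0 else j - 1 - a l)%N.
    apply: ndeg_prod => l'; case: eqP => [->|_].
      have [_ h _] := lP i.
      by have := @ndegX _ _ 0 (j - 1 - a i) h; rewrite muln0.
    by have := ndegX (j - 1 - a l') (ndeg_homog1 (c (Some i)) (hl l')); rewrite muln1.
  have := ndegM (ndegX 2 (fA i iA)) hR.
  have -> : (2 * (k - 1) + \sum_(l < s) (if l == i then 0 else j - 1 - a l))%N = (a i).-1.
    rewrite (bigD1 i) //= eqxx add0n; move: sumj; rewrite (bigD1 i) //=.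
    rewrite [in X in _ -> X](eq_bigr (fun l => j - 1 - a l)%N) => [|l' /negPf -> //].
    by have := a0 i; lia.
  by rewrite /ndeg prednK.
have [m mF] : exists m, m \in msupp F.
  case E: (msupp F) => [|m r]; last by exists m; rewrite inE eqxx.
  by case/eqP: F0; apply: msuppnil0.
have mj : mdeg m = j by have /dhomogP/(_ m mF) := hF.
have hm : ('X_[m] : P3) \is j.-homog by rewrite dhomogX /= mj.
have : hproj j 'X_[m] \in Ispace c (oapp a 3%N) j by rewrite Jf memvf.
case/IspaceP => g [hg]; rewrite hprojK // => XE.
have : apolar j.+1 F 'X_[m] = 0.
  rewrite XE linear_sum big1 // => t _.
  case: (leqP (oapp a 3%N t) j) => [le|lt]; last first.
    by rewrite (homog_of_neg _ (hg t)) ?mul0r ?linear0 //; lia.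
  have hgt : g t \is (j - oapp a 3%N t).-homog by apply/homog_ofP; rewrite -subzn.
  rewrite /= [g t * _]mulrC (apolar_linform_exp F (c t) hgt); last by rewrite subnK.
  have -> : iter (oapp a 3%N t) (dirder (c t)) F = 0.
    by case: t {hgt} le => [i|] //= le; apply: DA; have := aj i; lia.
  by rewrite /apolar big1 // => m' _; rewrite raddf0 mcoeff0 mulr0.
(* On a monomial from its own support [F] pairs to a coefficient times factorials, which is nonzero
   in characteristic zero. *)
rewrite apolarX ?mj // mcoeff_mderivm addm0 => /eqP; rewrite -mulr_natr mulf_eq0.
rewrite mcoeff_eq0 mF /=; apply/negP; apply: natr_neq0 => //.
by apply: prodn_gt0 => i; rewrite ffact_gt0.
Qed.

End Apolarity.

(** In degree [a i1 + a i2] the product of the two powers is a multiple of each, so the two summands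
    meet. *)
Lemma koszul_drop (K : fieldType) (s : nat) (c : 'I_s -> 'I_3 -> K) (a : 'I_s -> nat) j i1 i2 :
  i1 != i2 -> (forall i, (a i <= j)%N -> (i == i1) || (i == i2)) -> (a i1 + a i2)%N = j ->
  linform (c i1) != 0 -> linform (c i2) != 0 -> (\dim (Ispace c a j) < expdim a j)%N.
Proof.
move=> ne only ea L1 L2.
pose V i := mulV (j - a i) j (linform (c i) ^+ a i).
have sI : (Ispace c a j <= V i1 + V i2)%VS.
  apply/subv_sumP => i le_i; case/orP: (only i le_i) => /eqP ->; [exact: addvSl | exact: addvSr].
pose x : dhomog 3 K j := hproj j (linform (c i1) ^+ a i1 * linform (c i2) ^+ a i2).
have hL i := linform_exp_homog (c i) (a i).
have x0 : x != 0.
  have hx : linform (c i1) ^+ a i1 * linform (c i2) ^+ a i2 \is j.-homog.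
    by rewrite -ea; apply: dhomogM.
  apply/eqP => /(congr1 val); rewrite hprojK // => /eqP.
  by apply/negP; apply: mulf_neq0; apply: expf_neq0.
have xV1 : x \in V i1.
  have -> : x = hproj j (val (hproj (j - a i1) (linform (c i2) ^+ a i2)) * linform (c i1) ^+ a i1).
    by rewrite hprojK ?[in LHS]/x 1?mulrC // -ea addKn.
  exact: mem_mulV.
have xV2 : x \in V i2.
  have -> : x = hproj j (val (hproj (j - a i2) (linform (c i1) ^+ a i1)) * linform (c i2) ^+ a i2).
    by rewrite hprojK // -ea addnK.
  exact: mem_mulV.
have dcap : (0 < \dim (V i1 :&: V i2))%N.
  rewrite lt0n dimv_eq0; apply: contraNneq x0 => c0.
  by rewrite -memv0 -c0 memv_cap xV1.
have dsum := dimv_sum_cap (V i1) (V i2).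
have d1 : (\dim (V i1) <= 'C(j - a i1 + 2, j - a i1))%N := dim_mulV_le _ _ _.
have d2 : (\dim (V i2) <= 'C(j - a i2 + 2, j - a i2))%N := dim_mulV_le _ _ _.
have eE : ('C(j - a i1 + 2, j - a i1) + 'C(j - a i2 + 2, j - a i2) <= expdim a j)%N.
  have le1 : (a i1 <= j)%N by rewrite -ea leq_addr.
  have le2 : (a i2 <= j)%N by rewrite -ea leq_addl.
  rewrite /expdim (bigD1 i1) //= (bigD1 i2) /= ?le2 1?eq_sym //.
  by rewrite addnA leq_addr.
have := dimvS sI; lia.
Qed.

(** * From special to general forms *)

Section GenericPosition.
Variables (K : fieldType) (charK0 : [pchar K] =i pred0) (s : nat).
Local Notation N := (s.+1 * 3)%N.

Definition form_index (t : option 'I_s) : 'I_s.+1 := oapp (widen_ord (leqnSn s)) ord_max t.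

Definition coords (v : 'I_N -> K) (t : option 'I_s) (k : 'I_3) : K :=
  v (coef_index (form_index t) k).

Lemma coords_surj (c0 : option 'I_s -> 'I_3 -> K) : exists v, forall t, coords v t =1 c0 t.
Proof.
exists (fun x => mxvec (\matrix_(t < s.+1, k < 3) c0 (unlift ord_max t) k) 0 x) => t k.
rewrite /coords /coef_index mxvecE mxE; congr (c0 _ k).
case: t => [i|] /=; last by rewrite unlift_none.
by rewrite (_ : widen_ord _ i = lift ord_max i) ?liftK //; apply: val_inj; rewrite /= /bump leqNgt ltn_ord.
Qed.

Lemma linform_neq0 (c : 'I_3 -> K) k : c k != 0 -> linform c != 0.
Proof.
apply: contraNneq => c0; have : (linform c)@_U_(k) = 0 by rewrite c0 mcoeff0.
rewrite /linform raddf_sum (bigD1 k) //= mcoeffZ mcoeffXU eqxx mulr1 big1 ?addr0 => [-> //|l ne].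
by rewrite mcoeffZ mcoeffXU (negPf ne) mulr0.
Qed.

Lemma generic_linform_neq0 t : generic (fun v : 'I_N -> K => linform (coords v t) != 0).
Proof.
exists 'X_(coef_index (form_index t) ord0) => [|v]; first by rewrite -msize_poly_eq0 msizeX.
by rewrite mevalXU; apply: linform_neq0.
Qed.

Lemma generic_rank (a : 'I_s -> nat) j : (forall i, 0 < a i)%N -> (0 < j)%N ->
  generic (fun v : 'I_N -> K => 'C(j + 2, j) <= \dim (Ispace (coords v) (oapp a 3%N) j)
      + (defect j a - #|[set i | a i == j]|))%N.
Proof.
move=> a0 j0; have [c0 hc0] := special_rank charK0 a0 j0.
have [v0 hv0] := coords_surj c0.
set D := (defect j a - _)%N in hc0 *.
have hr : ('C(j + 2, j) - D <= \dim (Ispace (coords v0) (oapp a 3%N) j))%N.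
  rewrite (Ispace_eq (c' := c0)) => [|t _ k]; last exact: hv0.
  by rewrite leq_subLR [(D + _)%N]addnC.
apply: generic_imp (generic_dim_Ispace (sg := fun t k => coef_index (form_index t) k) hr) => v.
by rewrite leq_subLR [(D + _)%N]addnC.
Qed.

Lemma dot3 (u c : 'I_3 -> K) : dot u c = u ord0 * c ord0 + u (lift ord0 ord0) * c (lift ord0 ord0)
   + u (lift ord0 (lift ord0 ord0)) * c (lift ord0 (lift ord0 ord0)).
Proof. by rewrite /dot !big_ord_recl big_ord0 addr0 addrA. Qed.

Lemma generic_no_syzygy (a : 'I_s -> nat) n h :
  (forall i, 0 < a i)%N -> (2 <= h)%N -> #|[set i | (a i < n)%N]| = (2 * h)%N ->
  (\sum_(i < s) (n - 1 - a i) + 2 * h = n)%N -> (forall i, a i <> n) ->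
  generic (fun v : 'I_N -> K => expdim a n <= \dim (Ispace (fun i => coords v (Some i)) a n))%N.
Proof.
move=> a0 h2 cS sumn an; set S := [set i | (a i < n)%N] in cS.
have [A AS cA] : exists2 A : {set 'I_s}, A \subset S & #|A| = h.
  by apply: exists_subset_card; rewrite cS; lia.
pose B := S :\: A.
have cB : #|B| = h by rewrite cardsD (setIidPr AS) cS cA; lia.
have AB : [disjoint A & B] by rewrite -setI_eq0 /B setDE setICA setICr setI0.
have SE : A :|: B = S by rewrite /B setDE setUIr setUCr setIT; apply/setUidPr.
(* Positive integers keep [t i] and [t i + t l] nonzero, so the two lines share no chosen point and
   the separating lines below miss the other points. *)
pose t (i : 'I_s) : K := i.+1%:R.
have t0 i : t i != 0 by apply: natr_neq0.
have tI i l : (t i == t l) = (i == l).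
  by apply/eqP/eqP => [/(natr_inj charK0) [] /val_inj|->].
have tD i l : t i + t l != 0 by rewrite -natrD; apply: natr_neq0.
pose c (i : 'I_s) : 'I_3 -> K := if i \in A then vec3 1 (t i) 0 else vec3 1 0 (t i).
have memB l : l \in A :|: B -> (l \in B) = (l \notin A).
  by rewrite inE; case: (boolP (l \in A)) => [lA _|_ /= ->]; rewrite ?(disjointFr AB lA).
have Lc i : linform (c i) != 0.
  by apply: (@linform_neq0 _ ord0); rewrite /c; case: ifP => _; rewrite /vec3 /= oner_eq0.
have dotE x y z l : dot (vec3 x y z) (c l) = if l \in A then x + y * t l else x + z * t l.
  by rewrite dot3 /c /vec3; case: ifP => _ /=; rewrite ?mulr1 ?mulr0 ?addr0.
have sep : separated c (A :|: B).
  move=> i iAB; split=> //; case: (boolP (i \in A)) => iA.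
    (* On (1, t, 0) this line reads [t = t i], on (1, 0, t) it reads [t = - t i]; only the [i]-th
       point satisfies it. *)
    exists (vec3 (- t i) 1 (-1)) => l _; rewrite dotE; case: (boolP (l \in A)) => lA.
      by rewrite mul1r addrC subr_eq0 tI.
    rewrite mulN1r -opprD oppr_eq0 (negPf (tD _ _)).
    by apply/esym/negbTE; apply: contraNneq lA => ->.
  exists (vec3 (- t i) (-1) 1) => l _; rewrite dotE; case: (boolP (l \in A)) => lA.
    rewrite mulN1r -opprD oppr_eq0 (negPf (tD _ _)).
    by apply/esym/negbTE; apply: contraNneq iA => <-.
  by rewrite mul1r addrC subr_eq0 tI.
have hu1 l : l \in A :|: B -> (dot (vec3 0 0 1) (c l) == 0) = (l \in A).
  move=> _; rewrite dotE; case: (boolP (l \in A)) => lA; first by rewrite mul0r addr0 eqxx.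
  by rewrite mul1r add0r (negPf (t0 l)).
have hu2 l : l \in A :|: B -> (dot (vec3 0 1 0) (c l) == 0) = (l \in B).
  move=> /memB ->; rewrite dotE; case: (boolP (l \in A)) => lA; last by rewrite mul0r addr0 eqxx.
  by rewrite mul1r add0r (negPf (t0 l)).
have ns : no_syzygy c n (fun i => n.+1 - a i)%N.
  apply: (no_syzygy_lift charK0 AB cA cB h2 sep hu1 hu2) => [i|i|]; rewrite ?SE ?inE.
  - by move=> lt_i; lia.
  - by have := an i; lia.
  rewrite -[RHS]sumn; congr (_ + _)%N; rewrite big_mkcond; apply: eq_bigr => i _.
  by rewrite inE; case: ltnP => ?; lia.
have [v0 hv0] := coords_surj (oapp c (vec3 0 0 0)).
apply: (generic_dim_Ispace (sg := fun i k => coef_index (form_index (Some i)) k) (v0 := v0)).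
rewrite (Ispace_eq (c' := c)) => [|i _ k]; last exact: hv0.
by apply: expdim_no_syzygy.
Qed.

End GenericPosition.

(** * Arithmetic of the number [p] *)

Section Numerics.
Variables (s : nat) (a : 'I_s -> nat).
Hypothesis a0 : forall i, (0 < a i)%N.

Definition excess (q : nat) : nat := \sum_(i < s) (q - a i).

Lemma sum_excess j : (\sum_(i < s | (a i <= j)%N) (j.+1 - a i))%N = excess j.+1.
Proof.
rewrite big_mkcond; apply: eq_bigr => i _; case: leqP => [|lt] //.
by apply/esym/eqP; rewrite subn_eq0.
Qed.

Lemma excessS q : excess q.+1 = (excess q + #|[set i | (a i <= q)%N]|)%N.
Proof.
rewrite -sum1_card [X in (_ + X)%N]big_mkcond -big_split; apply: eq_bigr => i _ /=.
by rewrite inE; case: leqP => ?; lia.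
Qed.

Lemma card_le_lt_eq q : #|[set i | (a i <= q)%N]| =
  (#|[set i | (a i < q)%N]| + #|[set i | a i == q]|)%N.
Proof.
rewrite -!sum1_card [LHS]big_mkcond [X in (X + _)%N]big_mkcond [X in (_ + X)%N]big_mkcond.
by rewrite -big_split; apply: eq_bigr => i _ /=; rewrite !inE; case: ltngtP.
Qed.

(** Each truncated ratio [(q - a i) / q] increases with [q], so [excess q / q] is at most
    [excess p.+1 / p.+1], which is less than 1. *)
Lemma excess_lt p q : (excess p.+1 <= p)%N -> (0 < q <= p.+1)%N -> (excess q < q)%N.
Proof.
move=> hp /andP[q0 qp].
have le : (p.+1 * excess q <= q * excess p.+1)%N.
  rewrite /excess !big_distrr; apply: leq_sum => i _ /=.
  by rewrite !mulnBr [(q * p.+1)%N]mulnC leq_sub2l // leq_mul2r qp orbT.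
rewrite ltnNge; apply/negP => qE.
have : (p.+1 * q <= q * p)%N.
  apply: leq_trans (leq_trans le _); first by rewrite leq_mul2l qE orbT.
  by rewrite leq_mul2l hp orbT.
by rewrite mulnC leq_pmul2l // ltnn.
Qed.

Lemma defectE j : (0 < j)%N -> defect j a =
  (if (#|[set i | (a i < j)%N]| == j - excess j.-1) && ~~ odd #|[set i | (a i < j)%N]|
   then 1 else 3 * (j - excess j))%N.
Proof.
move=> j0; rewrite /defect (_ : (\sum_(i < s) (j - 1 - a i))%N = excess j.-1); last first.
  by rewrite /excess subn1.
case: ifP => // _; congr (3 * _)%N.
have := excessS j.-1; rewrite prednK // => ->.
rewrite (_ : #|[set i | (a i <= j.-1)%N]| = #|[set i | (a i < j)%N]|) ?subnDA //.
by apply: eq_card => i; rewrite !inE -ltnS prednK.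
Qed.

Lemma expdim_excess j : (0 < j)%N ->
  expdim a j = ((if 3 <= j then expdim a (j - 3) else 0) + 3 * excess j + #|[set i | a i == j]|)%N.
Proof.
move=> j0; rewrite expdim_step //.
have -> : excess j = (\sum_(i < s) (j - 1 - a i) + #|[set i | (a i < j)%N]|)%N.
  by case: j j0 => // j _; rewrite excessS subn1.
by rewrite mulnDr !addnA.
Qed.

Lemma expdim0 : expdim a 0 = 0%N.
Proof. by rewrite /expdim big1 // => i; rewrite leqn0 => /eqP e; have := a0 i; rewrite e. Qed.

End Numerics.

(** * Maximal rank degree by degree *)

Section MaximalRank.
Variables (K : fieldType) (s : nat) (a : 'I_s -> nat) (p : nat).
Variable c : option 'I_s -> 'I_3 -> K.
Hypothesis charK0 : [pchar K] =i pred0.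
Hypothesis a0 : forall i, (0 < a i)%N.
Hypothesis hp : (excess a p.+1 <= p)%N.
Hypothesis hp' : (p.+2 <= excess a p.+2)%N.
Local Notation I := (Ispace (fun i => c (Some i)) a).
Local Notation J := (Ispace c (oapp a 3%N)).
Local Notation G := (fun i : 'I_s => linform (c (Some i)) ^+ a i).
Local Notation M := (linform (c None) ^+ 3).
Local Notation nlt j := #|[set i | (a i < j)%N]|.
Local Notation neq j := #|[set i | a i == j]|.
Hypothesis L0 : forall t, linform (c t) != 0.
Hypothesis rankJ : forall j, (j < p + 4)%N -> (0 < j)%N ->
  ('C(j + 2, j) <= \dim (J j) + (defect j a - neq j))%N.

Let n3 j := (if 3 <= j then 'C(j - 3 + 2, j - 3) else 0)%N.
Let e3 j := (if 3 <= j then expdim a (j - 3) else 0)%N.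

Let rank_le j : (0 < j <= p.+1)%N ->
  ('C(j + 2, j) <= \dim (J j) + (3 * (j - excess a j) - neq j))%N.
Proof.
move=> /andP[j0 jp]; have := rankJ (j := j); rewrite defectE //.
have ltj := excess_lt hp (_ : 0 < j <= p.+1)%N.
have E := excessS a j.-1; rewrite prednK // in E.
have nE : #|[set i | (a i <= j.-1)%N]| = nlt j.
  by apply: eq_card => i; rewrite !inE -ltnS prednK.
rewrite nE in E; have lt : (excess a j < j)%N by apply: ltj; rewrite j0.
(* The tight case would mean [excess a j = j], whereas the excess is smaller than [j] here. *)
rewrite [X in if X then _ else _](_ : _ = false); last by apply/negbTE; lia.
by apply; lia.
Qed.

Let expected j : (0 < j <= p.+1)%N -> (neq j <= 3 * (j - excess a j))%N ->
  (n3 j + expdim a j <= \dim (J j) + e3 j)%N.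
Proof.
move=> hj le; have := rank_le hj; have := excess_lt hp hj.
case/andP: hj => j0 _; rewrite bin2_step // expdim_excess // -/(n3 j) -/(e3 j); lia.
Qed.

Let neq_le j : (0 < j <= p)%N -> (neq j <= 3 * (j - excess a j))%N.
Proof.
move=> /andP[j0 jp]; have := excess_lt hp (_ : 0 < j.+1 <= p.+1)%N.
by rewrite excessS card_le_lt_eq => /(_ _); lia.
Qed.

(** Induction in steps of three: the rank bound forces [J q] to be large, and by [dim_Jspace_le]
    with the known [I (q - 3)] this leaves no room for a syzygy in [I q]. *)
Lemma dim_Ispace_expected q : (q <= p)%N -> \dim (I q) = expdim a q.
Proof.
have [n] := ubnP q; elim: n => // n IH in q *; rewrite ltnS => qn qp.
apply/eqP; rewrite eqn_leq dim_Ispace_le /=.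
case: (posnP q) => [->|q0]; first by rewrite expdim0.
have := expected (j := q) _ (neq_le _); rewrite q0 qp (leqW qp) => /(_ isT isT).
rewrite /n3 /e3; case: (leqP 3 q) => [le3|lt3].
  have IHq : \dim (I (q - 3)) = expdim a (q - 3) by apply: IH; lia.
  have := dim_Jspace_le a (L0 None) le3; rewrite IHq.
  have arith (x y z t u : nat) : (z + t <= u + x -> x + y <= z + t -> y <= u)%N by lia.
  exact: arith.
by rewrite JspaceE (leqNgt 3 q) lt3 /= addv0 !add0n addn0.
Qed.

Lemma injective_low j : (3 <= j <= p.+1)%N -> (neq j <= 3 * (j - excess a j))%N ->
  mult_injective G a M j%:Z.
Proof.
move=> /andP[le3 jp] le_neq; apply/(mult_injectiveP a c le3); apply/(injectiveP_dim a (L0 None) le3).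
have := expected (j := j) _ le_neq; rewrite jp (leq_trans _ le3) // => /(_ isT).
have q3 : (j - 3 <= p)%N by lia.
rewrite /n3 /e3 le3 (dim_Ispace_expected q3).
have arith (x y z t : nat) : (x <= y -> z + y <= t -> x + z <= t)%N by lia.
exact: arith (dim_Ispace_le _ _ _).
Qed.

Lemma Jspace_fullP j : ('C(j + 2, j) <= \dim (J j))%N -> J j = fullv.
Proof. by move=> le; apply/eqP; rewrite eqEdim subvf dim_U. Qed.

(** If the forms with [a i = j] are too many for injectivity, they already reduce the bound on the
    cokernel to zero. *)
Lemma max_rank_low j : (3 <= j <= p.+1)%N -> mult_max_rank G a M j%:Z.
Proof.
move=> hj; have [le|lt] := leqP (neq j) (3 * (j - excess a j)).
  by left; apply: injective_low.
right; apply/(mult_surjectiveP a c)/Jspace_fullP.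
have := rank_le (j := j); move: hj => /andP[h3 hj]; rewrite hj (leq_trans _ h3) // => /(_ isT).
by lia.
Qed.

Let nltE j : (0 < j)%N -> excess a j = (excess a j.-1 + nlt j)%N.
Proof.
move=> j0; have := excessS a j.-1; rewrite prednK // => ->; congr (_ + _)%N.
by apply: eq_card => i; rewrite !inE -ltnS prednK.
Qed.

Lemma surjective_high j : (p.+3 <= j)%N -> mult_surjective G a M j%:Z.
Proof.
move=> le_j; apply/(mult_surjectiveP a c); rewrite -(subnK le_j).
elim: (j - p.+3)%N => [|k IH]; last by rewrite addSn; apply: Jspace_full_S.
rewrite add0n; apply: Jspace_fullP; have := rankJ (j := p.+3).
rewrite defectE // => /(_ _ isT); have := nltE (isT : (0 < p.+3)%N); rewrite [p.+3.-1]/= => E.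
have z : nlt p.+3 = 0%N -> excess a p.+2 = 0%N.
  move/eqP; rewrite cards_eq0 => /eqP S0; apply: big1 => i _.
  have : i \notin [set i | (a i < p.+3)%N] by rewrite S0 inE.
  by rewrite inE; lia.
(* A tight even case in degree [p + 3] would have at most one point, hence none, and then
   [excess a p.+2] would be 0. *)
case: ifP => [/andP[/eqP e ev]|_] H.
  have n1 : (nlt p.+3 <= 1)%N by rewrite e; lia.
  have : nlt p.+3 = 0%N by move: n1 ev; case: (nlt p.+3) => [|[|?]].
  by move/z; lia.
by apply: leq_trans (H _) _; [lia | case: (posnP (nlt p.+3)) => [/z|]; lia].
Qed.

Definition exceptional : bool :=
  [&& nlt p.+2 == (p.+2 - excess a p.+1)%N, (4 <= nlt p.+2)%N, ~~ odd (nlt p.+2) & neq p.+2 == 0%N].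

Lemma max_rank_critical : ~~ exceptional -> (3 <= p.+2)%N -> mult_max_rank G a M (p.+2)%:Z.
Proof.
move=> nex le3; have E := nltE (isT : (0 < p.+2)%N); rewrite [p.+2.-1]/= in E.
have H := rankJ (j := p.+2) _ isT; rewrite defectE // in H.
have {}H := H (_ : (p.+2 < p + 4)%N); rewrite [p.+2.-1]/= in H.
case: (boolP ((nlt p.+2 == (p.+2 - excess a p.+1)%N) && ~~ odd (nlt p.+2))) H => [/andP[/eqP e ev]|_] H; last first.
  right; apply/(mult_surjectiveP a c)/Jspace_fullP; have := H _; lia.
have [b0|b0] := posnP (neq p.+2); last first.
  right; apply/(mult_surjectiveP a c)/Jspace_fullP; have := H _; lia.
(* A tight even count below 4 is 0 or 2, and 0 contradicts [excess a p.+1 <= p]. *)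
have n2 : nlt p.+2 = 2%N.
  by move: nex; rewrite /exceptional e eqxx -e ev b0 eqxx /= andbT; move: ev; case: (nlt p.+2) e => [|[|[|[|?]]]] //=; lia.
left; apply/(mult_injectiveP a c le3); apply/(injectiveP_dim a (L0 None) le3).
have c2 : #|[set i | (a i < p.+2)%N]| == 2%N by apply/eqP.
have /cards2P[i1 [i2 [ne S2]]] := c2.
have memS i : (a i < p.+2)%N = (i == i1) || (i == i2).
  by rewrite -in_set2 -S2 inE.
have neqp i : a i != p.+2.
  by have := card0_eq b0 i; rewrite !inE => ->.
(* The tight count gives [a i1 + a i2 = p + 2], so the Koszul relation lies in this degree; the
   dimension it removes from [I] offsets the possible cokernel of dimension 1. *)
have kd : (\dim (I p.+2) < expdim a p.+2)%N.
  apply: (koszul_drop ne) => // [i le_i|]; first by rewrite -memS ltn_neqAle neqp.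
  have : excess a p.+1 = ((p.+1 - a i1) + (p.+1 - a i2))%N.
    rewrite /excess (bigD1 i1) //= (bigD1 i2) /= 1?eq_sym // big1 ?addn0 // => i /andP[h1 h2].
    have : ~~ (a i < p.+2)%N by rewrite memS negb_or h1 h2.
    by lia.
  have l1 : (a i1 < p.+2)%N by rewrite memS eqxx.
  have l2 : (a i2 < p.+2)%N by rewrite memS eqxx orbT.
  by lia.
have q3 : (p.+2 - 3 <= p)%N by lia.
rewrite (dim_Ispace_expected q3).
have := expdim_excess a (isT : (0 < p.+2)%N); have := bin2_step (isT : (0 < p.+2)%N).
rewrite le3 => h1 h2; have := H _; lia.
Qed.

Section Exceptional.
Hypothesis ex : exceptional.

Let facts : [/\ (nlt p.+2 + excess a p.+1 = p.+2)%N, (4 <= nlt p.+2)%N, ~~ odd (nlt p.+2),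
   neq p.+2 = 0%N & (3 <= p.+2)%N].
Proof.
by move: ex => /and4P[/eqP e h4 ev /eqP b0]; split => //; lia.
Qed.

Lemma exceptional_ge2 : (2 <= p)%N.
Proof. by have [e h4 _ _ _] := facts; lia. Qed.

(** The special position bounds the codimension by 1, and the apolar curve shows that it is not
    0. *)
Lemma dim_J_critical : ('C(p.+2 + 2, p.+2) = \dim (J p.+2) + 1)%N.
Proof.
have [e h4 ev b0 le3] := facts.
have := rankJ (j := p.+2) _ isT; rewrite defectE // [p.+2.-1]/=.
have c1 : nlt p.+2 == (p.+2 - excess a p.+1)%N by apply/eqP; lia.
rewrite c1 ev b0 /= => /(_ _) H; have {}H := H (_ : (p.+2 < p + 4)%N).
have lt : (\dim (J p.+2) < 'C(p.+2 + 2, p.+2))%N.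
  rewrite -(dim_U K) ltnNge; apply/negP => le.
  have := @Jspace_not_full K charK0 s p.+2 (nlt p.+2)./2 a c a0.
  have hk : nlt p.+2 = (2 * (nlt p.+2)./2)%N by rewrite mul2n even_halfK.
  apply => //; last by apply/eqP; rewrite eqEdim subvf.
  - by lia.
  - by rewrite -hk -[RHS]e addnC; congr (_ + _)%N; apply: eq_bigr => i _; rewrite subn1.
  by move=> i ai; have := card0_eq b0 i; rewrite !inE ai eqxx.
by have := H _; lia.
Qed.

Hypothesis indep : (expdim a p.+2 <= \dim (I p.+2))%N.

Let dimI : \dim (I p.+2) = expdim a p.+2.
Proof. by apply/eqP; rewrite eqn_leq indep dim_Ispace_le. Qed.

(** Here [excess a p.+2 = p.+2], so from degree [p - 1] to degree [p + 2] the whole ring and the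
    expected ideal both grow by [3 (p + 2)]. *)
Let binE : ('C(p.+2 + 2, p.+2) + expdim a (p.+2 - 3) = 'C(p.+2 - 3 + 2, p.+2 - 3) + expdim a p.+2)%N.
Proof.
have [e _ _ b0 le3] := facts; have E := nltE (isT : (0 < p.+2)%N); rewrite [p.+2.-1]/= in E.
have := expdim_excess a (isT : (0 < p.+2)%N); have := bin2_step (isT : (0 < p.+2)%N).
by rewrite le3; lia.
Qed.

Lemma dim_quotients_eq : ('C(p.+2 - 3 + 2, p.+2 - 3) - \dim (I (p.+2 - 3)) =
  'C(p.+2 + 2, p.+2) - \dim (I p.+2))%N.
Proof.
have q3 : (p.+2 - 3 <= p)%N by lia.
rewrite dimI (dim_Ispace_expected q3).
have arith (x y z t : nat) : (x + y = z + t -> z - y = x - t)%N by lia.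
exact: arith binE.
Qed.

(** Source and target have equal dimension and the cokernel is nonzero, so neither injectivity nor
    surjectivity can hold. *)
Lemma not_max_rank_critical : ~ mult_max_rank G a M (p.+2)%:Z.
Proof.
have [e h4 ev b0 le3] := facts; have dJ := dim_J_critical.
case=> [/(mult_injectiveP a c le3)/(injectiveP_dim a (L0 None) le3)|/(mult_surjectiveP a c) Jf].
  rewrite dimI (dim_Ispace_expected (_ : (p.+2 - 3 <= p)%N)); last by lia.
  have arith (x y z t u : nat) : (u = z + 1 -> u + t = y + x -> x + y <= z + t -> False)%N by lia.
  exact: arith dJ binE.
by move: dJ; rewrite Jf dim_U addn1 => /n_Sn.
Qed.

End Exceptional.

Lemma not_max_rank_eq (j : int) : ~ mult_max_rank G a M j -> exceptional /\ j = (p.+2)%:Z.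
Proof.
move=> nmr; have lt3 : ~ (j < 3).
  by move=> lt3; apply: nmr; left; apply: mult_injective_small.
case: j nmr lt3 => [j|j] nmr lt3; last by case: lt3.
have le3 : (3 <= j)%N by lia.
have [jp|pj] := leqP j p.+1.
  by case: nmr; apply: max_rank_low; rewrite le3.
have [pj'|jp] := leqP p.+3 j.
  by case: nmr; right; apply: surjective_high.
have ej : j = p.+2 by lia.
rewrite ej in nmr le3 *; split=> //; apply: contraT => nex.
by case: nmr; apply: max_rank_critical.
Qed.

End MaximalRank.

(** The bound [p + 4] keeps the number of conditions finite: it includes degree [p + 3], from which
    surjectivity passes to every higher degree. *)
Lemma generic_good (K : fieldType) (charK0 : [pchar K] =i pred0) (s : nat)
    (a : 'I_s -> nat) (p : nat) :
  (forall i, 0 < a i)%N ->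
  generic (fun v : 'I_(s.+1 * 3) -> K =>
    [/\ forall t, linform (coords v t) != 0,
        forall j, (j < p + 4)%N -> (0 < j)%N ->
          ('C(j + 2, j) <= \dim (Ispace (coords v) (oapp a 3%N) j)
             + (defect j a - #|[set i | a i == j]|))%N
      & exceptional a p ->
          (expdim a p.+2 <= \dim (Ispace (fun i => coords v (Some i)) a p.+2))%N]).
Proof.
move=> a0.
have g1 := generic_and (@generic_linform_neq0 K s None)
  (generic_forall_ord (fun i : 'I_s => @generic_linform_neq0 K s (Some i))).
have g2 : generic (fun v : 'I_(s.+1 * 3) -> K => forall j, (j < p + 4)%N -> (0 < j)%N ->
          ('C(j + 2, j) <= \dim (Ispace (coords v) (oapp a 3%N) j)
             + (defect j a - #|[set i | a i == j]|))%N).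
  apply: generic_forall_lt => j _; case: (posnP j) => [->|j0]; first exact: genericT.
  by apply: generic_imp (generic_rank charK0 a0 j0).
have g3 : generic (fun v : 'I_(s.+1 * 3) -> K => exceptional a p ->
          (expdim a p.+2 <= \dim (Ispace (fun i => coords v (Some i)) a p.+2))%N).
  case: (boolP (exceptional a p)) => [ex|_]; last exact: genericT.
  move: ex => /and4P[/eqP e h4 ev /eqP b0].
  have hk : #|[set i | (a i < p.+2)%N]| = (2 * #|[set i | (a i < p.+2)%N]|./2)%N.
    by rewrite mul2n even_halfK.
  apply: generic_imp (generic_no_syzygy charK0 a0 _ hk _ _) => //; first by lia.
    rewrite -hk (_ : (\sum_(i < s) _)%N = excess a p.+1); first by lia.
    by apply: eq_bigr => i _; rewrite subn1.
  by move=> i ai; have := card0_eq b0 i; rewrite !inE ai eqxx.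
apply: generic_imp (generic_and g1 (generic_and g2 g3)) => v [[hN hS] [h2 h3]].
by split=> // -[i|].
Qed.

Theorem theorem6p3 (K : fieldType) (charK0 : [pchar K] =i pred0)
  (s : nat) (hs : (3 <= s)%N) (a : 'I_s -> nat) (ha : forall i, (0 < a i)%N)
  (p : nat)
  (hp : (\sum_(i < s | (a i <= p)%N) (p.+1 - a i) <= p)%N)
  (hpmax : forall j : nat,
      (\sum_(i < s | (a i <= j)%N) (j.+1 - a i) <= j)%N -> (j <= p)%N) :
  exists P : {mpoly K[s.+1 * 3]}, P != 0 /\
  forall v : 'I_(s.+1 * 3) -> K, P.@[v] != 0 ->
    let G := fun i : 'I_s =>
      linform (fun k => v (coef_index (widen_ord (leqnSn s) i) k)) ^+ a i in
    let M := linform (fun k => v (coef_index ord_max k)) ^+ 3 in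
    let cnt := #|[set i : 'I_s | (a i <= p.+1)%N]| in
    let cond := [/\ cnt = (p.+2 - \sum_(i < s | (a i <= p)%N) (p.+1 - a i))%N,
                    (4 <= cnt)%N, ~~ odd cnt & forall i, a i <> p.+2] in
    ((exists j : int, ~ mult_max_rank G a M j) <-> cond) /\
    (cond ->
       (forall j : int, ~ mult_max_rank G a M j <-> j = (p.+2)%:Z) /\
       (exists n : nat,
          quot_dim (homog_of (p%:Z - 1)) (ideal_part G a (p%:Z - 1)) n /\
          quot_dim (homog_of (p.+2)%:Z) (ideal_part G a (p.+2)%:Z) n) /\
       quot_dim (homog_of (p.+2)%:Z) (mult_image_plus_ideal G a M (p.+2)%:Z) 1).
Proof.
have hp1 : (excess a p.+1 <= p)%N by rewrite -sum_excess.
have hp2 : (p.+2 <= excess a p.+2)%N.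
  rewrite ltnNge; apply/negP => le; have := hpmax p.+1; rewrite sum_excess ltnn.
  by move/(_ le).
have [P P0 HP] := generic_good charK0 p ha.
exists P; split=> // v /HP[L0 rankJ indep] G M cnt cond.
have condE : cond <-> exceptional a p.
  rewrite /cond /cnt sum_excess; split=> [[e h4 ev na]|/and4P[/eqP e h4 ev /eqP b0]].
    apply/and4P; split=> //; first by apply/eqP.
    by rewrite cards_eq0; apply/eqP/setP => i; rewrite !inE; apply/eqP/na.
  by split=> // i ai; have := card0_eq b0 i; rewrite !inE ai eqxx.
have only j : ~ mult_max_rank G a M j -> exceptional a p /\ j = (p.+2)%:Z.
  exact: (not_max_rank_eq ha hp1 hp2 L0 rankJ).
have crit : exceptional a p -> ~ mult_max_rank G a M (p.+2)%:Z.
  by move=> ex; exact: (not_max_rank_critical charK0 ha hp1 hp2 L0 rankJ ex (indep ex)).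
split; first split=> [[j /only[ex _]]|/condE ex].
- exact/condE.
- by exists (p.+2)%:Z; apply: crit.
move=> /condE ex; have p2 := exceptional_ge2 hp1 hp2 ex.
split; first by move=> j; split=> [/only[]|-> ]; last exact: crit.
split.
  (* The bound [p2] makes the truncated difference [p.+2 - 3] agree with the integer [p - 1]. *)
  have -> : p%:Z - 1 = (p.+2 - 3)%N%:Z by lia.
  exists ('C(p.+2 + 2, p.+2) - \dim (Ispace (fun i => coords v (Some i)) a p.+2))%N; split.
    rewrite -(dim_quotients_eq ha hp1 hp2 L0 rankJ ex (indep ex)).
    by apply: quot_dim_of_vspace => f hf; apply: ideal_part_hproj.
  by apply: quot_dim_of_vspace => f hf; apply: ideal_part_hproj.
have <- : ('C(p.+2 + 2, p.+2) - \dim (Ispace (coords v) (oapp a 3%N) p.+2) = 1)%N.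
  by rewrite (dim_J_critical charK0 ha hp1 hp2 rankJ ex) addKn.
by apply: quot_dim_of_vspace => f hf; apply: mult_imageP.
Qed.
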